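(* (a) Let $0<p<1/2$. There exists a martingale $f\in H_{p}(G_{m})$ such that \[ \omega\left(\frac{1}{M_{N}},f\right)_{H_{p}}=O\left(\frac{1}{M_{N}^{1/p-2}}\right)\quad\text{as } N\rightarrow\infty \] and \[ \left\Vert \sigma_{n}f-f\right\Vert_{L_{p,\infty}}\nrightarrow 0\quad\text{as } n\rightarrow\infty . \] (b) There exists a martingale $f\in H_{1/2}(G_{m})$ such that \[ \omega\left(\frac{1}{M_{N}},f\right)_{H_{1/2}}=O\left(\frac{1}{N^{2}}\right)\quad\text{as } N\rightarrow\infty \] and \[ \left\Vert \sigma_{n}f-f\right\Vert_{1/2}\nrightarrow 0\quad\text{as } n\rightarrow\infty . \]
   Context: Let $m=(m_0,m_1,\dots)$ be a bounded sequence of integers with $m_k\ge 2$ (bounded Vilenkin group). $G_m$ is the complete direct product of the cyclic groups $Z_{m_k}=\{0,\dots,m_k-1\}$ with the product topology and product Haar measure $\mu$ (each point of $Z_{m_k}$ has mass $1/m_k$), so $\mu(G_m)=1$. Put $M_0=1$, $M_{k+1}=m_kM_k$. Every $n\in\mathbb{N}$ is uniquely $n=\sum_j n_jM_j$ with $n_j\in Z_{m_j}$. The generalized Rademacher functions are $r_k(x)=\exp(2\pi\iota x_k/m_k)$ for $x=(x_0,x_1,\dots)\in G_m$, and the Vilenkin system is $\psi_n=\prod_k r_k^{n_k}$. For $x\in G_m$, $I_n(x)=\{y\in G_m: y_j=x_j,\ j<n\}$, and $\digamma_n$ is the $\sigma$-algebra generated by $\{I_n(x):x\in G_m\}$. For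 a martingale $f=(f^{(n)})$ with respect to $(\digamma_n)$, the maximal function is $f^*=\sup_n|f^{(n)}|$ and for $0<p<\infty$, $H_p(G_m)$ is the space of martingales with $\|f\|_{H_p}:=\|f^*\|_p<\infty$, where $\|g\|_p=(\int_{G_m}|g|^pd\mu)^{1/p}$. The weak quasinorm is $\|g\|_{L_{p,\infty}}=\sup_{\lambda>0}\lambda^p\mu(|g|>\lambda)$. The Fourier coefficients of a martingale are $\widehat f(i)=\lim_{k\to\infty}\int_{G_m}f^{(k)}\overline{\psi_i}\,d\mu$, the partial sums are $S_nf=\sum_{k=0}^{n-1}\widehat f(k)\psi_k$ ($S_0f=0$), and the Fejér means are $\sigma_nf=\frac1n\sum_{k=1}^nS_kf$. The modulus of continuity in $H_p$ is $\omega(1/M_n,f)_{H_p}:=\|f-S_{M_n}f\|_{H_p}$. *)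

(* Defs.v *)
From HB Require Import structures.
From mathcomp Require Import all_boot all_order all_algebra.
From mathcomp Require Import all_classical all_reals all_analysis.
From mathcomp Require Import complex.
Set Implicit Arguments. Unset Strict Implicit. Unset Printing Implicit Defensive.
Import Order.TTheory GRing.Theory Num.Theory.
Import numFieldNormedType.Exports.
Local Open Scope classical_set_scope.
Local Open Scope ring_scope.

Section Vilenkin.
Variables (R : realType) (m : nat -> nat).

Definition VC := R[i].
Definition cre (z : VC) : R := let: Complex a _ := z in a.
Definition cim (z : VC) : R := let: Complex _ b := z in b.
Definition cabs (z : VC) : R := Num.sqrt (cre z ^+ 2 + cim z ^+ 2).
Definition cconj (z : VC) : VC := (cre z -i* cim z)%C.
Definition cexp (th : R) : VC := (cos th +i* sin th)%C.

Definition VM (n : nat) : nat := \prod_(k < n) m k.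

Definition Gm : set (nat -> nat) := [set x | forall k, (x k < m k)%N].

(* The Haar measure mu on G_m is realised as the image of Lebesgue measure
   on [0,1) under the digit map t |-> (floor (M_{k+1} t) mod m_k)_k
   (the standard measure-isomorphism; it gives each I_n(x) measure 1/M_n). *)
Definition vdig (t : R) : nat -> nat :=
  fun k => ((Num.truncn ((VM k.+1)%:R * t)) %% m k)%N.

Definition I01 : set R := `[0%R, 1%R[.

Definition leb := (@lebesgue_measure R).

Definition Gmu (A : set (nat -> nat)) : \bar R := leb (I01 `&` vdig @^-1` A).

Definition cint (D : set R) (g : R -> VC) : VC :=
  (Rintegral leb D (fun t => cre (g t)) +i* Rintegral leb D (fun t => cim (g t)))%C.

Definition Gint (u : (nat -> nat) -> VC) : VC := cint I01 (fun t => u (vdig t)).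

Definition Lpe (p : R) (u : (nat -> nat) -> \bar R) : \bar R :=
  ((\int[leb]_(t in I01) (u (vdig t)) `^ p) `^ p^-1)%E.

Definition Lpnorm (p : R) (g : (nat -> nat) -> VC) : \bar R :=
  Lpe p (fun x => (cabs (g x))%:E).

Definition weakLp (p : R) (g : (nat -> nat) -> VC) : \bar R :=
  ereal_sup [set ((lam `^ p)%:E * Gmu [set x | (lam < cabs (g x))%R])%E
            | lam in [set lam : R | (0 < lam)%R]].

Definition rad (k : nat) (x : nat -> nat) : VC :=
  cexp (2 * pi * (x k)%:R / (m k)%:R).

Definition ndig (n j : nat) : nat := ((n %/ VM j) %% m j)%N.

(* psi_n = \prod_k r_k^{n_k}; since m_k >= 2, n_k = 0 for k >= n *)
Definition psi (n : nat) (x : nat -> nat) : VC :=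
  \prod_(k < n) rad k x ^+ ndig n k.

Definition mart := nat -> (nat -> nat) -> VC.

Definition upd (x : nat -> nat) (n a : nat) : nat -> nat :=
  fun j => if j == n then a else x j.

(* f^(n) is F_n-measurable (constant on each I_n(x)) and
   E(f^(n+1) | F_n) = f^(n), i.e. f^(n) is the average of f^(n+1) over I_n(x). *)
Definition is_martingale (f : mart) : Prop :=
  (forall n x y, Gm x -> Gm y -> (forall j, (j < n)%N -> x j = y j) ->
     f n x = f n y) /\
  (forall n x, Gm x ->
     f n x = (((m n)%:R^-1)%:C)%C * \sum_(a < m n) f n.+1 (upd x n a)).

Definition maxf (f : mart) (x : nat -> nat) : \bar R :=
  ereal_sup [set (cabs (f n x))%:E | n in [set: nat]].

Definition Hpnorm (p : R) (f : mart) : \bar R := Lpe p (maxf f).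

Definition in_Hp (p : R) (f : mart) : Prop :=
  is_martingale f /\ (Hpnorm p f < +oo)%E.

Definition clim (s : nat -> VC) : VC :=
  (limn (fun k => cre (s k)) +i* limn (fun k => cim (s k)))%C.

Definition fhat (f : mart) (i : nat) : VC :=
  clim (fun k => Gint (fun x => f k x * cconj (psi i x))).

Definition Spart (f : mart) (n : nat) (x : nat -> nat) : VC :=
  \sum_(k < n) fhat f k * psi k x.

Definition fejer (f : mart) (n : nat) (x : nat -> nat) : VC :=
  (((n%:R)^-1)%:C)%C * \sum_(1 <= k < n.+1) Spart f k x.

(* E(g | F_n)(x) = (1/mu(I_n(x))) \int_{I_n(x)} g dmu, mu(I_n(x)) = 1/M_n *)
Definition condexp (n : nat) (g : (nat -> nat) -> VC) (x : nat -> nat) : VC :=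
  (((VM n)%:R)%:C)%C *
  cint [set t | I01 t /\ forall j, (j < n)%N -> vdig t j = x j]
       (fun t => g (vdig t)).

(* omega(1/M_n, f)_{H_p} = || f - S_{M_n} f ||_{H_p}, where the function
   S_{M_n} f is regarded as the martingale (E(S_{M_n} f | F_k))_k *)
Definition omegaHp (p : R) (n : nat) (f : mart) : \bar R :=
  Hpnorm p (fun k x => f k x - condexp k (Spart f (VM n)) x).

(* the function represented by the martingale f: the (a.e.) limit of f^(n) *)
Definition fval (f : mart) (x : nat -> nat) : VC := clim (fun n => f n x).

End Vilenkin.

(* Main.v *)
(* The counterexamples are martingales f = sum_i b_i (D_(M_(i+1)) - D_(M_i)), with
   b_i = M_i in (a), and b_i = M_i / i^2 for i a power of 2 and b_i = 0 otherwise
   in (b). Since D_(M_i) = M_i 1_(I_i(0)), subadditivity of u |-> u^p bounds the p-th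
   power of the norm of f - S_(M_N) f by 2 sum_(i >= N) b_i^p M_i^(p-1).

   Off I_s(0) both f and S_(M_s) f equal f^(s), and for n = M_s + q with q <= M_s,
     n (sigma_n f - f) = M_s (sigma_(M_s) f - f) + b_s psi_(M_s) q K_q,
   so one of the two errors is at least of the size of (b_s / n) |q K_q|. In (a), q = 1
   makes this term at least 1/2. In (b), s = 2^i and q = sum_(j < s/3) M_(3j)
   give the integral of |q K_q|^(1/2) a lower bound c s. *)
Require Import Defs.
From HB Require Import structures.
From mathcomp Require Import all_boot all_order all_algebra.
From mathcomp Require Import all_classical all_reals all_analysis.
From mathcomp Require Import complex measurable_realfun.
From mathcomp Require Import zify ring lra.
Set Implicit Arguments. Unset Strict Implicit. Unset Printing Implicit Defensive.
Import Order.TTheory GRing.Theory Num.Theory.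
Import numFieldNormedType.Exports.
Local Open Scope classical_set_scope.
Local Open Scope ring_scope.

(** The exponent 1/2 is the borderline. With b_i = M_i the terms b_i^p M_i^(p-1) equal M_i^(2p-1),
    which decay geometrically for p < 1/2 but are all 1 at p = 1/2. Damping by 1/i^2 turns them into
    1/i there, and keeping only powers of 2 replaces the divergent harmonic series by one with tails
    O(1/N); the outer power 1/p = 2 yields O(1/N^2). The price is a factor 1/s in (b_s / n)^(1/2),
    and this is what the lower bound c s has to repay.

    Comparing the orders M_s and M_s + q removes any need to know how sigma_(M_s) f - f behaves: one
    of the two errors is large, and both orders tend to infinity with s.

    The function f is only an almost everywhere limit. Off I_s(0), however, f^(n) no longer changes
    for n >= s, so every pointwise identity is finite, and only the point t = 0 is exceptional. *)

(** * Modulus, conjugation and exponential on the complex numbers *)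

Section Unimodular.
Variable R : realType.
Implicit Types (z w : VC R) (a b : R).

Lemma cabsE z : cabs z = ComplexField.Normc.normc z.
Proof. by case: z. Qed.

Lemma cabsM z w : cabs (z * w) = cabs z * cabs w.
Proof. by rewrite !cabsE ComplexField.Normc.normcM. Qed.

Lemma cabsN z : cabs (- z) = cabs z.
Proof. by case: z => a b; rewrite /cabs /= !sqrrN. Qed.

Lemma cabs_ge0 z : 0 <= cabs z.
Proof. exact: sqrtr_ge0. Qed.

Lemma ler_cabsD z w : cabs (z + w) <= cabs z + cabs w.
Proof. by have := ler_normD z w; rewrite !normc_def -rmorphD lecR; case: z w => ? ? [? ?]. Qed.

Lemma cabs_real a : cabs (a%:C)%C = `|a|.
Proof. by rewrite /cabs /= expr0n addr0 sqrtr_sqr. Qed.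

Lemma cconjM z w : cconj (z * w) = cconj z * cconj w.
Proof. by case: z w => a b [c d]; apply/eqP; rewrite eq_complex /=; apply/andP; split; apply/eqP; ring. Qed.

Lemma cconjX z n : cconj (z ^+ n) = cconj z ^+ n.
Proof.
elim: n => [|n IH]; last by rewrite !exprS cconjM IH.
by rewrite !expr0; apply/eqP; rewrite eq_complex /= oppr0 !eqxx.
Qed.

Lemma mulr_cconj z : cabs z = 1 -> z * cconj z = 1.
Proof.
case: z => a b /(congr1 (fun x => x ^+ 2)).
rewrite /cabs sqr_sqrtr/= ?addr_ge0 ?sqr_ge0// expr1n => h.
by apply/eqP; rewrite eq_complex /=; apply/andP; split; apply/eqP;
  [rewrite -h; ring|ring].
Qed.

Lemma cexpD a b : cexp (a + b) = cexp a * cexp b.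
Proof. by apply/eqP; rewrite eq_complex /= cosD sinD eqxx; apply/andP; split=> //; apply/eqP; ring. Qed.

Lemma cexp0 : cexp 0 = 1 :> VC R.
Proof. by rewrite /cexp cos0 sin0. Qed.

Lemma cexpXn a n : cexp a ^+ n = cexp (a *+ n).
Proof.
by elim: n => [|n IH]; rewrite ?expr0 ?mulr0n ?cexp0// exprS IH mulrS cexpD.
Qed.

Lemma cabs_cexp a : cabs (cexp a) = 1.
Proof. by rewrite /cabs/= cos2Dsin2 sqrtr1. Qed.

Lemma cexp2pi n : cexp (pi *+ 2 *+ n) = 1 :> VC R.
Proof.
rewrite -cexpXn (_ : cexp _ = 1) ?expr1n//.
by rewrite /cexp cos2pi sin2pi.
Qed.

(** Half-angle formula: cos a = 1 - 2 sin(a/2)^2, and a/2 lies strictly between 0 and pi. *)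
Lemma cexp_neq1 a : 0 < a -> a < pi *+ 2 -> cexp a != 1.
Proof.
move=> a0 a2; apply/negP => /eqP[] ca _.
have s0 : 0 < sin (a / 2).
  by apply: sin_gt0_pi; rewrite ?divr_gt0// ltr_pdivrMr// mulr_natr.
have := cosD (a / 2) (a / 2); rewrite -splitr ca -!expr2 cos2sin2 => h.
have : sin (a / 2) ^+ 2 = 0 by lra.
by move/eqP; rewrite sqrf_eq0 gt_eqF.
Qed.

Lemma sum_geom_eq0 z n : z ^+ n = 1 -> z != 1 -> \sum_(a < n) z ^+ a = 0.
Proof.
move=> zn z1; have := subrX1 z n; rewrite zn subrr => /esym/eqP.
by rewrite mulf_eq0 subr_eq0 (negbTE z1) => /eqP.
Qed.

End Unimodular.

Lemma sum_ord_blocks (V : nmodType) (G : nat -> V) (M a c : nat) :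
  \sum_(k < a * M + c) G k =
  \sum_(i < a) \sum_(k < M) G (i * M + k)%N + \sum_(k < c) G (a * M + k)%N.
Proof.
suff h b d : \sum_(k < b + d) G k = \sum_(k < b) G k + \sum_(k < d) G (b + k)%N.
  rewrite h; congr (_ + _); elim: a => [|a IH]; first by rewrite mul0n !big_ord0.
  by rewrite mulSn addnC h IH big_ord_recr.
elim: d => [|d IH]; first by rewrite addn0 big_ord0 addr0.
by rewrite addnS !big_ord_recr /= IH addrA.
Qed.

(** * Vilenkin functions and their Dirichlet and Fejér sums *)

Section Characters.
Variables (R : realType) (m : nat -> nat).
Hypothesis m_ge2 : forall k, (2 <= m k)%N.
Local Notation VM := (VM m).
Local Notation psi := (@Defs.psi R m).
Local Notation rad := (@Defs.rad R m).
Local Notation ndig := (ndig m).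
Implicit Types (x : nat -> nat).

Lemma m_gt0 k : (0 < m k)%N. Proof. exact: leq_trans (m_ge2 k). Qed.

Lemma VM0 : VM 0 = 1%N. Proof. by rewrite /VM big_ord0. Qed.

Lemma VMS n : VM n.+1 = (VM n * m n)%N.
Proof. by rewrite /VM big_ord_recr. Qed.

Lemma VM_gt0 n : (0 < VM n)%N.
Proof. by apply: prodn_gt0 => i; exact: m_gt0. Qed.

Lemma leq_VM_double n : (2 * VM n <= VM n.+1)%N.
Proof. by rewrite VMS mulnC leq_mul2l m_ge2 orbT. Qed.

Lemma ltn_VM n : (n < VM n)%N.
Proof. by elim: n => [|n IH]; [rewrite VM0|have := leq_VM_double n; lia]. Qed.

Lemma leq_VM i j : (i <= j)%N -> (VM i <= VM j)%N.
Proof.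
move=> /subnK <-; elim: (j - i)%N => [//|d IH]; rewrite addSn.
by have := leq_VM_double (d + i); lia.
Qed.

Lemma dvdn_VM i j : (i <= j)%N -> (VM i %| VM j)%N.
Proof.
move=> /subnK <-; elim: (j - i)%N => [//|d IH]; rewrite addSn VMS.
exact: dvdn_mulr.
Qed.

Lemma ndig_small n k j : (n < VM k)%N -> (k <= j)%N -> ndig n j = 0%N.
Proof.
by move=> nk /leq_VM kj; rewrite /ndig divn_small ?mod0n// (leq_trans nk).
Qed.

(** No carry occurs: [c] occupies the positions below [t] and a M_t the others. *)
Lemma ndigMD a c t j : (c < VM t)%N ->
  ndig (a * VM t + c) j = if (j < t)%N then ndig c j else ndig (a * VM t) j.
Proof.
move=> ct; case: ltnP => [jt|tj]; rewrite /ndig.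
  have /dvdnP[e ->] := dvdn_VM jt; rewrite VMS.
  rewrite (_ : a * (e * (VM j * m j)) = (a * e * m j) * VM j)%N; last by lia.
  by rewrite divnMDl ?VM_gt0// modnMDl.
have /dvdnP[e ->] := dvdn_VM tj; rewrite (mulnC e) !divnMA.
by rewrite divnMDl ?VM_gt0// (divn_small ct) addn0 mulnK ?VM_gt0.
Qed.

Lemma ndigM_lt a t j : (j < t)%N -> ndig (a * VM t) j = 0%N.
Proof.
move=> jt; rewrite -[X in ndig X]addn0 ndigMD ?VM_gt0// jt.
by rewrite /ndig div0n mod0n.
Qed.

Lemma ndigM_eq a t : (a < m t)%N -> ndig (a * VM t) t = a.
Proof. by move=> am; rewrite /ndig mulnK ?VM_gt0// modn_small. Qed.

(** All further digits vanish, so both products agree with the one of length n + K. A freely chosen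
    [K] lets several indices share one range of digits. *)
Lemma psiE n K x : (n < VM K)%N -> psi n x = \prod_(k < K) rad k x ^+ ndig n k.
Proof.
have h d L : (n < VM L)%N -> \prod_(k < d + L) rad k x ^+ ndig n k =
    \prod_(k < L) rad k x ^+ ndig n k.
  move=> nL; elim: d => // d IH; rewrite addSn big_ord_recr /= IH.
  by rewrite (ndig_small nL) ?leq_addl// expr0 mulr1.
move=> nK; rewrite -(h n K nK) addnC (h K n)//; exact: ltn_VM.
Qed.

Lemma psi0 x : psi 0 x = 1.
Proof. by rewrite /psi big_ord0. Qed.

Lemma psiMD a c t x : (c < VM t)%N ->
  psi (a * VM t + c) x = psi (a * VM t) x * psi c x.
Proof.
move=> ct; set n := (a * VM t + c)%N; pose K := maxn t n.
have nK : (n < VM K)%N.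
  by apply: leq_trans (ltn_VM n) _; apply: leq_VM; rewrite leq_maxr.
rewrite !(psiE (K := K))//; try by apply: leq_ltn_trans nK; rewrite ?leq_addr ?leq_addl.
rewrite -big_split; apply: eq_bigr => k _ /=.
rewrite /n ndigMD//; case: ltnP => kt; first by rewrite ndigM_lt// expr0 mul1r.
by rewrite (ndig_small ct kt) expr0 mulr1.
Qed.

Lemma psi_rad a t x : (a < m t)%N -> psi (a * VM t) x = rad t x ^+ a.
Proof.
move=> am; rewrite (psiE (K := t.+1)); last by rewrite VMS mulnC ltn_pmul2l ?VM_gt0.
rewrite big_ord_recr /= ndigM_eq// big1 ?mul1r// => i _.
by rewrite ndigM_lt.
Qed.

Lemma rad_unity k x : rad k x ^+ m k = 1.
Proof.
rewrite /rad cexpXn -(cexp2pi R (x k)); congr cexp.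
rewrite -[LHS]mulr_natr -mulrA mulVf ?pnatr_eq0 -?lt0n ?m_gt0//.
by rewrite mulr1 mulr_natr mulr_natl.
Qed.

Lemma rad_neq1 k x : (0 < x k < m k)%N -> rad k x != 1.
Proof.
case/andP => x0 xm; apply: cexp_neq1.
  by rewrite divr_gt0 ?mulr_gt0 ?pi_gt0 ?ltr0n ?m_gt0.
rewrite ltr_pdivrMr ?ltr0n ?m_gt0// -[pi *+ 2]mulr_natl.
by rewrite ltr_pM2l ?ltr_nat// mulr_gt0 ?pi_gt0.
Qed.

Lemma rad0 k x : x k = 0%N -> rad k x = 1.
Proof. by move=> xk; rewrite /rad xk mulr0 mul0r cexp0. Qed.

Lemma cabs_rad k x : cabs (rad k x) = 1.
Proof. exact: cabs_cexp. Qed.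

Lemma cabs_exp1 (z : VC R) n : cabs z = 1 -> cabs (z ^+ n) = 1.
Proof.
move=> z1; elim: n => [|n IH]; last by rewrite exprS cabsM z1 IH mulr1.
by rewrite expr0 (_ : 1 = (1%:C)%C)// cabs_real normr1.
Qed.

Lemma cabs_psi n x : cabs (psi n x) = 1.
Proof.
rewrite /psi; elim/big_ind : _ => [|y z hy hz|i _].
- by rewrite (_ : 1 = (1%:C)%C)// cabs_real normr1.
- by rewrite cabsM hy hz mulr1.
- exact/cabs_exp1/cabs_rad.
Qed.

Definition Dk n x : VC R := \sum_(k < n) psi k x.

(* [Fk n.+1] is [n] times the Fejer kernel of order [n]. *)
Definition Fk n x : VC R := \sum_(l < n) Dk l x.

Lemma DkMD a c t x : (c <= VM t)%N ->
  Dk (a * VM t + c) x =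
  (\sum_(i < a) psi (i * VM t) x) * Dk (VM t) x + psi (a * VM t) x * Dk c x.
Proof.
move=> ct; rewrite /Dk (sum_ord_blocks (psi ^~ x)) mulr_suml mulr_sumr.
congr (_ + _); apply: eq_bigr => i _; last by rewrite psiMD// (leq_trans _ ct).
by rewrite mulr_sumr; apply: eq_bigr => j _; rewrite psiMD.
Qed.

(** In general each block also picks up multiples of D_(M_t); where D_(M_t) vanishes, every block is
    the first one times a character. *)
Lemma FkMD a c t x : (c <= VM t)%N -> Dk (VM t) x = 0 ->
  Fk (a * VM t + c) x =
  (\sum_(i < a) psi (i * VM t) x) * Fk (VM t) x + psi (a * VM t) x * Fk c x.
Proof.
move=> ct D0; rewrite /Fk (sum_ord_blocks (Dk ^~ x)) mulr_suml mulr_sumr.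
have h b d : (d < VM t)%N -> Dk (b * VM t + d) x = psi (b * VM t) x * Dk d x.
  by move=> /ltnW dt; rewrite DkMD// D0 mulr0 add0r.
congr (_ + _); apply: eq_bigr => i _; last by rewrite h// (leq_trans _ ct).
by rewrite mulr_sumr; apply: eq_bigr => j _; rewrite h.
Qed.

Lemma Dk_VMS t x :
  Dk (VM t.+1) x = (\sum_(a < m t) rad t x ^+ a) * Dk (VM t) x.
Proof.
have -> : VM t.+1 = (m t * VM t + 0)%N by rewrite VMS addn0 mulnC.
rewrite DkMD// [Dk 0 x]/Dk big_ord0 mulr0 addr0; congr (_ * _).
by apply: eq_bigr => i _; rewrite psi_rad.
Qed.

Lemma Fk_VMS t x : Dk (VM t) x = 0 ->
  Fk (VM t.+1) x = (\sum_(a < m t) rad t x ^+ a) * Fk (VM t) x.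
Proof.
move=> D0; have -> : VM t.+1 = (m t * VM t + 0)%N by rewrite VMS addn0 mulnC.
rewrite FkMD// [Fk 0 x]/Fk big_ord0 mulr0 addr0; congr (_ * _).
by apply: eq_bigr => i _; rewrite psi_rad.
Qed.

Lemma Dk_VM_eq0 t j x : (j < t)%N -> (0 < x j < m j)%N -> Dk (VM t) x = 0.
Proof.
move=> jt xj; rewrite -(subnK jt); elim: (t - _)%N => [|d IH].
  by rewrite Dk_VMS sum_geom_eq0 ?mul0r ?rad_unity ?rad_neq1.
by rewrite addSn Dk_VMS IH mulr0.
Qed.

Lemma psi_eq1 n t x : (n < VM t)%N -> (forall j, (j < t)%N -> x j = 0%N) ->
  psi n x = 1.
Proof.
move=> nt x0; rewrite (psiE _ nt) big1// => i _.
by rewrite rad0 ?expr1n// x0.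
Qed.

Lemma Dk_small n t x : (n <= VM t)%N -> (forall j, (j < t)%N -> x j = 0%N) ->
  Dk n x = n%:R.
Proof.
move=> nt x0; rewrite /Dk (eq_bigr (fun=> 1)) ?sumr_const ?card_ord// => i _.
by rewrite (psi_eq1 _ x0)// (leq_trans _ nt).
Qed.

(* Two nonzero digits of [x] below [t] kill both sums over full blocks of length
   [M_t], which isolates the contribution of the remainder [c]. *)
Lemma Fk_two_digits a c s x : (c <= VM s)%N ->
  (forall j, (j < s)%N -> x j = 0%N) ->
  (0 < x s < m s)%N -> (0 < x s.+1 < m s.+1)%N ->
  Fk (a * VM s.+2 + c) x = psi (a * VM s.+2) x * (\sum_(l < c) l%:R).
Proof.
move=> cs x0 xs xs1.
rewrite FkMD ?(Dk_VM_eq0 (j := s))//; last by rewrite (leq_trans cs)// leq_VM// ltnW.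
(* Digit [s] only provides the vanishing of D_(M_(s+1)) and D_(M_(s+2)); it is digit [s.+1] that
   annihilates the Fejér sum of a full block. *)
rewrite Fk_VMS ?(Dk_VM_eq0 (j := s))// sum_geom_eq0 ?rad_unity ?rad_neq1//.
rewrite mul0r mulr0 add0r; congr (_ * _); apply: eq_bigr => l _.
by rewrite (Dk_small _ x0)// ltnW// (leq_trans _ cs).
Qed.

End Characters.

(** * The digit map on [0, 1[, cylinder sets and measurability *)

Section Cells.
Variables (R : realType) (m : nat -> nat).
Hypothesis m_ge2 : forall k, (2 <= m k)%N.
Local Notation VM := (VM m).
Local Notation vdig := (@Defs.vdig R m).
Local Notation Gm := (Gm m).
Local Notation I01 := (@Defs.I01 R).
Local Notation leb := (@Defs.leb R).
Implicit Types (x y : nat -> nat) (t : R).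

(** This is measurability with respect to F_n, whose atoms are the sets I_n(x). *)
Definition fdep (T : Type) n (u : (nat -> nat) -> T) := forall x y, Gm x -> Gm y ->
  (forall j, (j < n)%N -> x j = y j) -> u x = u y.

Lemma fdepW T n k (u : (nat -> nat) -> T) : (n <= k)%N -> fdep n u -> fdep k u.
Proof. by move=> nk h x y Gx Gy xy; apply: h => // j jn; apply: xy; exact: leq_trans nk. Qed.

Lemma fdep_comp T T' n (u : (nat -> nat) -> T) (g : T -> T') : fdep n u -> fdep n (g \o u).
Proof. by move=> h x y Gx Gy xy /=; rewrite (h x y). Qed.

Definition tau n t := Num.truncn ((VM n)%:R * t).

Fixpoint enc n x : nat := if n is k.+1 then (enc k x * m k + x k)%N else 0%N.

(* The copy of [I_n(x)] in [0, 1[; it is the interval where the integer part of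
   [M_n t] is the mixed-radix number [enc n x]. *)
Definition cell n x : set R := [set t | I01 t /\ forall j, (j < n)%N -> vdig t j = x j].

Lemma VMr_gt0 n : 0 < (VM n)%:R :> R.
Proof. by rewrite ltr0n VM_gt0. Qed.

Lemma vdig_Gm t : Gm (vdig t).
Proof. by move=> k; rewrite ltn_mod m_gt0. Qed.

Lemma upd_Gm n a x : (a < m n)%N -> Gm x -> Gm (upd x n a).
Proof. by move=> am Gx k; rewrite /upd; case: eqP => [->|_]. Qed.

Lemma truncnM_divn (z : R) k : (0 < k)%N -> 0 <= z ->
  (Num.truncn (z * k%:R) %/ k)%N = Num.truncn z.
Proof.
move=> k0 z0; apply/esym/truncn_def.
have zk0 : 0 <= z * k%:R by rewrite mulr_ge0.
have /andP[lo hi] := truncn_itv zk0.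
set T := Num.truncn _ in lo hi *; have kr0 : 0 < k%:R :> R by rewrite ltr0n.
apply/andP; split.
  by rewrite -(ler_pM2r kr0) (le_trans _ lo)// -natrM ler_nat leq_trunc_div.
rewrite -(ltr_pM2r kr0) (lt_le_trans hi)// -natrM ler_nat.
by rewrite ltn_ceil.
Qed.

(** Horner's rule: since floor(floor(z k) / k) = floor(z), the quotient of floor(M_(n+1) t) by m_n
    is floor(M_n t), and its remainder is the digit [n]. *)
Lemma tauS n t : 0 <= t -> tau n.+1 t = (tau n t * m n + vdig t n)%N.
Proof.
move=> t0; rewrite /Defs.vdig -/(tau n.+1 t) [LHS](divn_eq _ (m n)).
congr (_ * _ + _)%N; rewrite /tau VMS natrM -mulrA [_ * t]mulrC mulrA.
by rewrite truncnM_divn ?m_gt0// mulr_ge0.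
Qed.

Lemma tau0P t : 0 <= t -> tau 0 t = 0%N <-> t < 1.
Proof.
move=> t0; rewrite /tau VM0 mul1r; split=> [h|h].
  by have /andP[_] := truncn_itv t0; rewrite h.
by apply: truncn_def; rewrite t0 h.
Qed.

(** Induction on [n]: by uniqueness of Euclidean division, [tau n.+1 t] determines the last digit
    and [tau n t]. At n = 0 the condition says t < 1. *)
Lemma cellP n x t : Gm x -> cell n x t <-> 0 <= t /\ tau n t = enc n x.
Proof.
move=> Gx; elim: n => [|n IH].
  split=> [[]|[t0 /(tau0P t0) t1]]; last by split=> //; rewrite /= /Defs.I01/= in_itv/= t0.
  by rewrite /= /Defs.I01/= in_itv/= => /andP[t0 /(tau0P t0)].
split=> [[It h]|[t0]].
  have [t0 tn] : 0 <= t /\ tau n t = enc n x.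
    by apply/IH; split=> // j jn; rewrite h// ltnW.
  by split=> //; rewrite tauS// tn h.
rewrite tauS//= => /[dup] /(congr1 (fun k => k %/ m n)%N) + /(congr1 (fun k => k %% m n)%N).
rewrite !divnMDl ?m_gt0// !modnMDl !modn_small ?divn_small ?vdig_Gm ?Gx// !addn0.
move=> tn xn; have [It h] : cell n x t by apply/IH.
by split=> // j; rewrite ltnS leq_eqVlt => /predU1P[->|/h].
Qed.

Lemma cell_itv n x : Gm x ->
  cell n x = `[(enc n x)%:R / (VM n)%:R, (enc n x).+1%:R / (VM n)%:R[%classic.
Proof.
move=> Gx; have V0 := VMr_gt0 n; apply/seteqP; split=> t.
  move=> /(cellP _ _ Gx)[t0 tn]; rewrite /= in_itv/= ler_pdivrMr// ltr_pdivlMr//.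
  by rewrite mulrC -tn; apply: truncn_itv; rewrite mulr_ge0.
rewrite /= in_itv/= => /andP[lo hi]; apply/(cellP _ _ Gx).
have t0 : 0 <= t by rewrite (le_trans _ lo)// divr_ge0.
split=> //; apply: truncn_def.
by rewrite mulrC -ler_pdivrMr// -ltr_pdivlMr// lo.
Qed.

Lemma measurable_cell n x : Gm x -> measurable (cell n x).
Proof. by move=> Gx; rewrite cell_itv. Qed.

Lemma leb_cell n x : Gm x -> leb (cell n x) = ((VM n)%:R^-1)%:E.
Proof.
move=> Gx; rewrite cell_itv// /Defs.leb lebesgue_measure_itv/= lte_fin.
rewrite ltr_pM2r ?invr_gt0 ?VMr_gt0// ltr_nat ltnSn -EFinB -mulrBl.
by rewrite -natrB// subSnn mul1r.
Qed.

Lemma cell_sub n x : cell n x `<=` I01.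
Proof. by move=> t []. Qed.

Lemma cell0 x : cell 0 x = I01.
Proof. by apply/seteqP; split=> [t []|t It]//; split. Qed.

Lemma measurable_I01 : measurable (I01 : set R).
Proof. exact: measurable_itv. Qed.

Lemma leb_I01 : leb I01 = 1%E.
Proof. by rewrite /Defs.leb /Defs.I01 lebesgue_measure_itv/= lte_fin ltr01 oppr0 adde0. Qed.

Lemma tau_ltVM n t : I01 t -> (tau n t < VM n)%N.
Proof.
rewrite /Defs.I01/= in_itv/= => /andP[t0 t1]; rewrite /tau truncn_lt_nat ?mulr_ge0//.
by rewrite gtr_pMr// VMr_gt0.
Qed.

Lemma tau_inj n s t : 0 <= s -> 0 <= t -> tau n s = tau n t ->
  forall j, (j < n)%N -> vdig s j = vdig t j.
Proof.
move=> s0 t0; elim: n => [//|n IH]; rewrite !tauS//.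
move=> /[dup] /(congr1 (fun k => k %/ m n)%N) + /(congr1 (fun k => k %% m n)%N).
rewrite !divnMDl ?m_gt0// !modnMDl !modn_small ?divn_small ?vdig_Gm// !addn0.
by move=> /IH h st j; rewrite ltnS leq_eqVlt => /predU1P[->|/h].
Qed.

Lemma tau_natr n k : tau n (k%:R / (VM n)%:R) = k.
Proof. by rewrite /tau mulrC mulfVK ?natrK// gt_eqF// VMr_gt0. Qed.

Lemma fdep_tau T n (u : (nat -> nat) -> T) t : fdep n u -> I01 t ->
  u (vdig t) = u (vdig ((tau n t)%:R / (VM n)%:R)).
Proof.
rewrite /Defs.I01/= in_itv/= => h /andP[t0 t1].
apply: h; [exact: vdig_Gm|exact: vdig_Gm|].
by apply: tau_inj => //; rewrite ?divr_ge0 ?tau_natr.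
Qed.

(** The left endpoint k / M_n represents its interval, so an F_n-measurable function pulls back to a
    step function; measurability and boundedness are read off from this. *)
Lemma fdep_step n (u : (nat -> nat) -> R) : fdep n u ->
  {in I01, forall t, u (vdig t) = \sum_(k < VM n) u (vdig (k%:R / (VM n)%:R)) *
    \1_(`[k%:R / (VM n)%:R, k.+1%:R / (VM n)%:R[%classic) t}.
Proof.
move=> h t; rewrite inE => It.
have Itt : 0 <= t by move: It; rewrite /Defs.I01/= in_itv/= => /andP[].
have E (k : nat) : (t \in `[k%:R / (VM n)%:R, k.+1%:R / (VM n)%:R[) = (tau n t == k).
  by rewrite in_itv/= ler_pdivrMr ?ltr_pdivlMr ?VMr_gt0// mulrC truncn_eq// mulr_ge0.
rewrite (bigD1 (Ordinal (tau_ltVM n It)))//= big1 => [|k kt].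
  rewrite addr0 indicE (_ : _ \in _ = true) ?mulr1; first exact: fdep_tau.
  by apply/mem_set; rewrite /= E.
rewrite indicE (_ : _ \in _ = false) ?mulr0//; apply/negbTE.
apply/negP => /set_mem/=; rewrite E => /eqP tk; move: kt => /eqP; apply.
exact/val_inj.
Qed.

Lemma fdep_measurable n (u : (nat -> nat) -> R) : fdep n u ->
  measurable_fun I01 (u \o vdig).
Proof.
move=> h; apply: eq_measurable_fun.
  by move=> t It; rewrite /= (fdep_step h It).
by apply: measurable_sum => k; apply: measurable_funM.
Qed.

Lemma fdep_integrable n (u : (nat -> nat) -> R) : fdep n u ->
  (@lebesgue_measure R).-integrable I01 (EFin \o (u \o vdig)).
Proof.
move=> h; apply: measurable_bounded_integrable.
- exact: measurable_I01.
- exact: (eq_ind_r (fun z => (z < +oo)%E) (ltry 1) leb_I01).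
- exact: fdep_measurable h.
exists (\sum_(k < VM n) `|u (vdig (k%:R / (VM n)%:R))|); split; first exact: num_real.
move=> M /ltW hM t It; apply: le_trans hM.
rewrite /= (fdep_tau h It) (bigD1 (Ordinal (tau_ltVM n It)))//= lerDl.
exact: sumr_ge0.
Qed.

End Cells.

(** * Conditional expectations and Fourier coefficients of block martingales *)

Section Martingales.
Variables (R : realType) (m : nat -> nat).
Hypothesis m_ge2 : forall k, (2 <= m k)%N.
Local Notation VM := (VM m).
Local Notation vdig := (@Defs.vdig R m).
Local Notation Gm := (Gm m).
Local Notation I01 := (@Defs.I01 R).
Local Notation leb := (@Defs.leb R).
Local Notation psi := (@Defs.psi R m).
Local Notation rad := (@Defs.rad R m).
Local Notation cell := (@cell R m).
Implicit Types (x y : nat -> nat) (t : R).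

Lemma cell_bigsetU n x : Gm x ->
  cell n x = \big[setU/set0]_(a < m n) cell n.+1 (upd x n a).
Proof.
move=> Gx; rewrite -(bigcup_mkord (m n) (fun a => cell n.+1 (upd x n a))).
apply/seteqP; split=> [t [It h]|t [a/= am [It h]]].
  exists (vdig t n); first exact: vdig_Gm.
  split=> // j; rewrite ltnS leq_eqVlt /upd => /predU1P[->|jn]; first by rewrite eqxx.
  by rewrite ltn_eqF// h.
by split=> // j jn; rewrite h ?ltnS ?(ltnW jn)// /upd ltn_eqF.
Qed.

Lemma Rintegral_cell_split K n x (u : (nat -> nat) -> R) : fdep m K u -> Gm x ->
  Rintegral leb (cell n x) (u \o vdig) =
  \sum_(a < m n) Rintegral leb (cell n.+1 (upd x n a)) (u \o vdig).
Proof.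
move=> hu Gx.
have Gu (a : 'I_(m n)) : Gm (upd x n a) by exact: upd_Gm.
have iu k y : Gm y -> (@lebesgue_measure R).-integrable (cell k y) (EFin \o (u \o vdig)).
  move=> Gy; apply: integrableS (fdep_integrable m_ge2 hu).
  - exact: measurable_I01.
  - exact: measurable_cell.
  - exact: cell_sub.
rewrite /Rintegral cell_bigsetU//.
rewrite (integral_bigsetU_EFin (@lebesgue_measure R) (F := fun a : 'I_(m n) => cell n.+1 (upd x n a))).
- rewrite -sum_fine// => a _; apply: integrable_fin_num.
    exact: measurable_cell.
  exact: iu.
- by move=> a; exact: measurable_cell.
- exact: index_enum_uniq.
- apply/trivIsetP => a b _ _ ab; apply/seteqP; split=> // t [[_ ha] [_ hb]].
  have := ha n (ltnSn n); rewrite (hb n (ltnSn n)) /upd eqxx => /val_inj ba.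
  by move: ab; rewrite ba eqxx.
- rewrite -cell_bigsetU//; exact: (measurable_int (@lebesgue_measure R) (iu n x Gx)).
Qed.

Lemma condexp_id n (u : (nat -> nat) -> VC R) x : fdep m n u -> Gm x ->
  condexp m n u x = u x.
Proof.
move=> hu Gx; have V0 := VMr_gt0 R m_ge2 n.
have h (w : (nat -> nat) -> R) : fdep m n w ->
    Rintegral leb (cell n x) (fun t => w (vdig t)) = w x / (VM n)%:R.
  move=> hw; transitivity (Rintegral leb (cell n x) (cst (w x))).
    apply: eq_Rintegral => t /set_mem [It ht]; apply: hw => //; exact: vdig_Gm.
  rewrite /Defs.leb Rintegral_cst; last exact: measurable_cell.
  by congr (_ * _); rewrite [X in fine X](leb_cell R m_ge2 n Gx).
rewrite /condexp -/(cell n x) /cint (h (@cre R \o u)) ?(h (@cim R \o u)); try exact: fdep_comp.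
rewrite /=; case: (u x) (V0) => a b {}V0 /=; apply/eqP; rewrite eq_complex /=.
by apply/andP; split; apply/eqP; field; rewrite gt_eqF.
Qed.

Lemma condexp_split K n (u : (nat -> nat) -> VC R) x : fdep m K u -> Gm x ->
  condexp m n u x =
  (((m n)%:R^-1)%:C)%C * \sum_(a < m n) condexp m n.+1 u (upd x n a).
Proof.
move=> hu Gx; rewrite /condexp -/(cell n x) /cint.
rewrite (@Rintegral_cell_split K _ _ (@cre R \o u))//; last exact: fdep_comp.
rewrite (@Rintegral_cell_split K _ _ (@cim R \o u))//; last exact: fdep_comp.
rewrite -mulr_sumr mulrA -rmorphM VMS natrM mulrCA mulVf ?mulr1; last first.
  by rewrite pnatr_eq0 -lt0n m_gt0.
congr (_ * _); elim/big_rec3 : _ => [//|a y1 y2 y3 _ <-].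
by apply/eqP; rewrite eq_complex /= !eqxx.
Qed.

(** For n < k the digits between [n] and [k] are averaged out one at a time, by induction on the gap
    k - n. *)
Lemma condexp_mart (f : mart R) n k x : is_martingale m f -> Gm x ->
  condexp m n (f k) x = f (minn n k) x.
Proof.
move=> [hf1 hf2] Gx; case: (leqP k n) => [kn|/ltnW nk].
  by apply: condexp_id => //; exact: fdepW kn (hf1 k).
rewrite -(subnK nk); move: (k - n)%N => d {nk}; elim: d n x Gx => [|d IH] n x Gx.
  by apply: condexp_id => //; exact: hf1.
rewrite addSn -addnS (@condexp_split (d + n.+1)) ?hf2//; last exact: hf1.
by congr (_ * _); apply: eq_bigr => a _; rewrite IH//; exact: upd_Gm.
Qed.

Lemma Gint_mart (f : mart R) k x : is_martingale m f -> Gm x ->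
  Gint m (f k) = f 0%N x.
Proof.
move=> hf Gx; have := condexp_mart 0 k hf Gx; rewrite min0n => <-.
by rewrite /condexp -/(cell 0 x) (VM0 m) cell0 mul1r.
Qed.

Lemma eq_Gint (u v : (nat -> nat) -> VC R) : (forall x, Gm x -> u x = v x) ->
  Gint m u = Gint m v.
Proof.
move=> uv; rewrite /Gint; congr cint; apply/funext => t.
by rewrite uv//; exact: vdig_Gm.
Qed.

Lemma clim_near (s : nat -> VC R) (l : VC R) n : (forall k, (n <= k)%N -> s k = l) ->
  clim s = l.
Proof.
move=> h; rewrite /clim; case: l h => a b h.
by congr (_ +i* _)%C; apply: lim_near_cst => //; exists n => // k /= nk; rewrite h.
Qed.

(** This replaces the evaluation of integrals: once f^(k) times the conjugate of psi_i is recognised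
    as a martingale from rank [n] on, its integrals are constant, equal to the initial value. *)
Lemma fhat_mart (f g : mart R) i n x : is_martingale m g -> Gm x ->
  (forall k y, (n <= k)%N -> Gm y -> f k y * cconj (psi i y) = g k y) ->
  fhat m f i = g 0%N x.
Proof.
move=> hg Gx fg; apply: (clim_near (n := n)) => k nk.
by rewrite -(Gint_mart k hg Gx); apply: eq_Gint => y Gy; exact: fg.
Qed.

Lemma psi_fdep n i : (i < VM n)%N -> fdep m n (psi i).
Proof.
move=> iV x y _ _ xy; rewrite !(psiE R m_ge2 _ iV); apply: eq_bigr => k _.
by rewrite /Defs.rad xy.
Qed.

Definition zprefix n x := [forall j : 'I_n, x j == 0%N].

(* [dk n] is the Dirichlet kernel of order [M_n] (see [Dk_VM]), so that [block b] has
   Fourier coefficient [b i] at every index [j] with [M_i <= j < M_(i+1)]. *)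
Definition dk n x : R := if zprefix n x then (VM n)%:R else 0.

Definition blockr (b : nat -> R) n x : R := \sum_(i < n) b i * (dk i.+1 x - dk i x).

Definition block (b : nat -> R) : mart R := fun n x => ((blockr b n x)%:C)%C.

Lemma zprefixP n x : reflect (forall j, (j < n)%N -> x j = 0%N) (zprefix n x).
Proof.
apply: (iffP forallP) => h j; last by apply/eqP/h.
by move=> jn; apply/eqP/(h (Ordinal jn)).
Qed.

Lemma zprefixS n x : zprefix n.+1 x = zprefix n x && (x n == 0%N).
Proof.
apply/zprefixP/andP => [h|[/zprefixP h /eqP xn] j].
  by split; [apply/zprefixP => j jn; apply: h; exact: ltnW|rewrite h].
by rewrite ltnS leq_eqVlt => /predU1P[->//|/h].
Qed.

Lemma eq_zprefix n x y : (forall j, (j < n)%N -> x j = y j) -> zprefix n x = zprefix n y.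
Proof. by move=> h; apply: eq_forallb => j; rewrite h. Qed.

Lemma zprefix_upd n x a : zprefix n (upd x n a) = zprefix n x.
Proof. by apply: eq_zprefix => j jn; rewrite /upd ltn_eqF. Qed.

Lemma zprefixW n k x : (n <= k)%N -> zprefix k x -> zprefix n x.
Proof. by move=> nk /zprefixP h; apply/zprefixP => j jn; apply: h; exact: leq_trans nk. Qed.

Lemma dk_fdep n : fdep m n (dk n).
Proof. by move=> x y _ _ xy; rewrite /dk (eq_zprefix xy). Qed.

Lemma dk_upd n x a : dk n (upd x n a) = dk n x.
Proof. by rewrite /dk zprefix_upd. Qed.

Lemma dkS_upd n x a : dk n.+1 (upd x n a) = if a == 0%N then (m n)%:R * dk n x else 0.
Proof.
rewrite /dk zprefixS zprefix_upd /upd eqxx VMS natrM mulrC.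
by case: zprefix; case: (a == _); rewrite ?mulr0 ?mul0r.
Qed.

Lemma sum_ord0 n (F : nat -> R) : \sum_(a < m n) (if val a == 0%N then F a else 0) = F 0%N.
Proof.
by rewrite -big_mkcond/= (big_pred1 (Ordinal (m_gt0 m_ge2 n))).
Qed.

Lemma dk_mart n x : \sum_(a < m n) dk n.+1 (upd x n a) = (m n)%:R * dk n x.
Proof.
by under eq_bigr do rewrite dkS_upd; rewrite (sum_ord0 n (fun=> (m n)%:R * dk n x)).
Qed.

Lemma blockr_fdep b n : fdep m n (blockr b n).
Proof.
move=> x y Gx Gy xy; apply: eq_bigr => i _; congr (_ * (_ - _)); apply: dk_fdep => // j ji;
by apply: xy; apply: leq_trans (ltn_ord i); rewrite // ltnW.
Qed.

Lemma blockrS_upd b n x a :  Gm x -> (a < m n)%N ->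
  blockr b n.+1 (upd x n a) = blockr b n x + b n * (dk n.+1 (upd x n a) - dk n x).
Proof.
move=> Gx am; rewrite /blockr big_ord_recr /= dk_upd; congr (_ + _).
apply: (@blockr_fdep b n) => //; first exact: upd_Gm.
by move=> j jn; rewrite /upd ltn_eqF.
Qed.

Lemma mr_neq0 n : (m n)%:R != 0 :> R.
Proof. by rewrite pnatr_eq0 -lt0n m_gt0. Qed.

Lemma block_mart b : is_martingale m (block b).
Proof.
split=> [n x y Gx Gy xy|n x Gx]; first by rewrite /block (blockr_fdep b Gx Gy xy).
rewrite /block -rmorph_sum -rmorphM; congr (_%:C)%C.
under eq_bigr => a _ do rewrite blockrS_upd//.
rewrite big_split /= sumr_const card_ord -mulr_sumr sumrB dk_mart sumr_const card_ord.
rewrite -(mulr_natl (dk n x)) subrr mulr0 addr0 -(mulr_natl (blockr b n x)).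
by rewrite mulKf// mr_neq0.
Qed.

Lemma sum_cconj_rad n x c : (0 < c < m n)%N ->
  \sum_(a < m n) cconj (rad n (upd x n a)) ^+ c = 0.
Proof.
(* Digit and exponent can be exchanged, since both sides are exp(-2 pi i a c / m_n); the sum becomes
   geometric with ratio [z]. *)
move=> cm; pose z := cconj (rad n (upd x n c)).
have -> : \sum_(a < m n) cconj (rad n (upd x n a)) ^+ c = \sum_(a < m n) z ^+ a.
  apply: eq_bigr => a _; rewrite /z -!cconjX /Defs.rad /upd eqxx !cexpXn.
  by congr (cconj (cexp _)); rewrite -!(mulr_natr (_ / _)); ring.
apply: sum_geom_eq0.
  by rewrite -cconjX rad_unity// /cconj /= oppr0.
have : rad n (upd x n c) != 1 by apply: rad_neq1; rewrite // /upd eqxx.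
apply: contra => /eqP h; apply/eqP.
by have := mulr_cconj (cabs_rad R m n (upd x n c)); rewrite -/z h mulr1.
Qed.

Lemma fhat_block b s i : (VM s <= i < VM s.+1)%N -> fhat m (block b) i = ((b s)%:C)%C.
Proof.
(* The leading digit of [i], at position [s]. Being nonzero, it makes the sum of the characters over
   the digit [s] vanish. *)
case/andP => si iS; pose c := (i %/ VM s)%N.
have V0 := VM_gt0 m_ge2 s.
have c0 : (0 < c < m s)%N by rewrite divn_gt0// si ltn_divLR// mulnC -VMS.
have psiu x a : Gm x -> (a < m s)%N -> cconj (psi i (upd x s a)) =
    cconj (psi (i %% VM s) x) * cconj (rad s (upd x s a)) ^+ c.
  move=> Gx am; rewrite [in LHS](divn_eq i (VM s)) psiMD ?ltn_pmod// mulrC cconjM.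
  rewrite psi_rad//; last by case/andP: c0.
  rewrite cconjX (psi_fdep (n := s) _ (y := x))// ?ltn_pmod//; first exact: upd_Gm.
  by move=> j js; rewrite /upd ltn_eqF.
(* Averaging [block b s.+1 * conj (psi i)] over the digit [s] kills everything except
   the new mass at the zero digit, where [psi i = 1]; this leaves [b s * dk s]. *)
pose g : mart R := fun n x => if (n <= s)%N then ((b s * dk n x)%:C)%C
  else block b n x * cconj (psi i x).
have Gz : Gm (fun=> 0%N) by move=> k; exact: m_gt0.
have psid n x y : (s < n)%N -> Gm x -> Gm y -> (forall j, (j < n)%N -> x j = y j) ->
    psi i x = psi i y.
  move=> sn; apply: (psi_fdep (n := n)); apply: leq_trans iS _; exact: leq_VM.
have gm : is_martingale m g.
  split=> [n x y Gx Gy xy|n x Gx]; rewrite /g.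
    case: leqP => [_|sn]; first by rewrite (dk_fdep Gx Gy xy).
    by rewrite /block (blockr_fdep b Gx Gy xy) (psid n x y).
  case: (ltngtP n s) => [ns|sn|->].
  + rewrite -rmorph_sum -rmorphM -mulr_sumr dk_mart; congr (_%:C)%C.
    by rewrite mulrCA mulKf// mr_neq0.
  + have [_ /(_ n x Gx) ->] := block_mart b; rewrite -mulrA mulr_suml.
    apply: (congr1 (fun z => _ * z)).
    apply: eq_bigr => a _; have au : Gm (upd x n a) by exact: upd_Gm.
    by rewrite (psid n (upd x n a) x) => [||||j jn] //; rewrite /upd ltn_eqF.
  + under eq_bigr => a _ do rewrite psiu// /block blockrS_upd// mulrBr addrCA rmorphD mulrDl.
    rewrite big_split /= -mulr_sumr -mulr_sumr sum_cconj_rad// !mulr0 addr0.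
    have E (a : 'I_(m s)) : ((b s * dk s.+1 (upd x s a))%:C)%C *
        (cconj (psi (i %% VM s) x) * cconj (rad s (upd x s a)) ^+ c) =
        ((b s * dk s.+1 (upd x s a))%:C)%C.
      rewrite dkS_upd; case: eqP => [a0|_]; last by rewrite mulr0 mul0r.
      rewrite rad0; last by rewrite /upd eqxx a0.
      rewrite /dk; case: zprefixP => zs; last by rewrite !mulr0 mul0r.
      rewrite (psi_eq1 R m_ge2 (t := s)) ?ltn_pmod//.
      have -> : cconj 1 = 1 :> VC R by rewrite /cconj /= oppr0.
      by rewrite expr1n !mulr1.
    under eq_bigr => a _ do rewrite E.
    rewrite -rmorph_sum -rmorphM -mulr_sumr dk_mart; congr (_%:C)%C.
    by rewrite mulrCA mulKf// mr_neq0.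
have -> : fhat m (block b) i = g 0%N (fun=> 0%N).
  by apply: (fhat_mart (n := s.+1)) => // k y sk Gy; rewrite /g leqNgt sk.
rewrite /g /dk (_ : zprefix 0 _); last exact/zprefixP.
by rewrite VM0 mulr1.
Qed.

Lemma fhat_block0 b : fhat m (block b) 0 = 0.
Proof.
have Gz : Gm (fun=> 0%N) by move=> k; exact: m_gt0.
rewrite (@fhat_mart _ (block b) 0 0%N (fun=> 0%N))//.
- by rewrite /block /blockr big_ord0.
- exact: block_mart.
- move=> k y _ _; rewrite psi0; have -> : cconj 1 = 1 :> VC R by rewrite /cconj /= oppr0.
  by rewrite mulr1.
Qed.

Lemma Dk_VM n x : Gm x -> Dk R m (VM n) x = ((dk n x)%:C)%C.
Proof.
move=> Gx; rewrite /dk; case: zprefixP => [z|].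
  by rewrite (Dk_small R m_ge2 _ z)// rmorph_nat.
move=> /zprefixP; rewrite negb_forall => /existsP[j xj].
by rewrite (Dk_VM_eq0 R m_ge2 (ltn_ord j))// lt0n xj Gx.
Qed.

(** All coefficients with index in [M_s, M_(s+1)[ equal b_s, so the increment is b_s times a
    difference of Dirichlet kernels. *)
Lemma Spart_block_add b s q x : (VM s + q <= VM s.+1)%N ->
  Spart m (block b) (VM s + q) x =
  Spart m (block b) (VM s) x + ((b s)%:C)%C * (Dk R m (VM s + q) x - Dk R m (VM s) x).
Proof.
move=> sq; rewrite /Spart /Dk; have D (F : nat -> VC R) :
  \sum_(k < VM s + q) F k = \sum_(k < VM s) F k + \sum_(k < q) F (VM s + k)%N.
  by have := sum_ord_blocks F (VM s) 1 q; rewrite mul1n big_ord1.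
rewrite (D (fun k => fhat m (block b) k * psi k x)) (D (psi ^~ x)).
rewrite [X in _ * X]addrC addKr mulr_sumr; congr (_ + _).
apply: eq_bigr => k _; rewrite (@fhat_block b s)// leq_addr.
by rewrite (leq_trans _ sq)// ltn_add2l.
Qed.

Lemma Spart_block b n x : Gm x -> Spart m (block b) (VM n) x = block b n x.
Proof.
move=> Gx; elim: n => [|n IH].
  by rewrite VM0 /Spart big_ord1 fhat_block0 mul0r /block /blockr big_ord0.
have nS : (VM n <= VM n.+1)%N by exact: leq_VM.
have := @Spart_block_add b n (VM n.+1 - VM n) x; rewrite subnKC// => ->//.
by rewrite IH !Dk_VM// /block /blockr big_ord_recr /= rmorphD rmorphM rmorphB.
Qed.

End Martingales.

(** * Upper bounds for the Hardy norm and the modulus of continuity *)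

Section HardyNorm.
Variables (R : realType) (m : nat -> nat).
Hypothesis m_ge2 : forall k, (2 <= m k)%N.
Local Notation VM := (VM m).
Local Notation vdig := (@Defs.vdig R m).
Local Notation Gm := (Gm m).
Local Notation I01 := (@Defs.I01 R).
Local Notation leb := (@Defs.leb R).
Local Notation cell := (@cell R m).
Local Notation dk := (@dk R m).
Local Notation blockr := (@blockr R m).
Local Notation block := (@block R m).
Implicit Types (x y : nat -> nat) (t p : R) (b T : nat -> R).

(** For r in ]0, 1] and p <= 1 one has r <= r^p. Applied to a / (a + c) and c / (a + c), which add
    up to 1, this gives the claim. *)
Lemma powR_subadd p (a c : R) : 0 < p -> p <= 1 -> 0 <= a -> 0 <= c ->
  (a + c) `^ p <= a `^ p + c `^ p.
Proof.
move=> p0 p1 a0 c0; have [s0|s0] := eqVneq (a + c) 0.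
  by rewrite s0 powR0 ?gt_eqF// addr_ge0// powR_ge0.
have sp : 0 < a + c by rewrite lt_neqAle eq_sym s0 addr_ge0.
have h (z : R) : 0 <= z -> z <= a + c -> z / (a + c) * (a + c) `^ p <= z `^ p.
  move=> z0 zs; have [->|zn] := eqVneq z 0; first by rewrite !mul0r powR_ge0.
  have q0 : 0 < z / (a + c) by rewrite divr_gt0// lt_neqAle eq_sym zn.
  have q1 : 0 < z / (a + c) <= 1 by rewrite q0 ler_pdivrMr// mul1r.
  apply: le_trans (ler_wpM2r (powR_ge0 (a + c) p) (ger1_powR q1 p1)) _.
  rewrite -powRM; [|exact: ltW|exact: ltW].
  by rewrite mulfVK// lexx.
have := lerD (h a a0 _) (h c c0 _); rewrite -mulrDl -mulrDl mulfV ?gt_eqF// mul1r.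
by apply; rewrite ?lerDl ?lerDr.
Qed.

Lemma powR_subadd_sum p (I : Type) (r : seq I) (F : I -> R) : 0 < p -> p <= 1 ->
  (forall i, 0 <= F i) -> (\sum_(i <- r) F i) `^ p <= \sum_(i <- r) F i `^ p.
Proof.
move=> p0 p1 F0; elim: r => [|i r IH]; first by rewrite !big_nil powR0 ?gt_eqF.
rewrite !big_cons; apply: le_trans (powR_subadd p0 p1 _ _) _ => //.
  exact: sumr_ge0.
by rewrite lerD2l.
Qed.

Lemma ler_powRN (r x y : R) : r <= 0 -> 0 < x -> x <= y -> y `^ r <= x `^ r.
Proof.
move=> r0 x0 xy; have y0 := lt_le_trans x0 xy.
have h : x `^ (- r) <= y `^ (- r).
  by apply: ge0_ler_powR; rewrite ?nnegrE ?oppr_ge0// ltW.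
by rewrite -[r]opprK !(powRN _ (- r)) lef_pV2// posrE powR_gt0.
Qed.

Lemma dk_ge0 n x : 0 <= dk n x.
Proof. by rewrite /dk; case: ifP. Qed.

Lemma Gm0 : Gm (fun=> 0%N).
Proof. by move=> k; exact: m_gt0. Qed.

Lemma dk_vdig n t : I01 t -> dk n (vdig t) = (VM n)%:R * \1_(cell n (fun=> 0%N)) t.
Proof.
move=> It; rewrite /dk indicE; case: zprefixP => h.
  by rewrite mem_set ?mulr1//; split.
by rewrite memNset ?mulr0// => -[_ /h].
Qed.

Lemma integral_dk_powR p n : 0 < p ->
  (\int[leb]_(t in I01) (dk n (vdig t) `^ p)%:E = ((VM n)%:R `^ (p - 1))%:E)%E.
Proof.
move=> p0; pose C := cell n (fun=> 0%N).
have mC : measurable C by exact: (measurable_cell m_ge2 n Gm0).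
transitivity (\int[leb]_(t in I01) (((VM n)%:R `^ p)%:E * (\1_C t)%:E))%E.
  apply: eq_integral => t /set_mem It; rewrite dk_vdig// powRM// -EFinM.
  congr (_ * _)%:E; rewrite indicE; case: (_ \in _); rewrite ?powR1//.
  by rewrite powR0 ?gt_eqF.
rewrite /Defs.leb ge0_integralZl_EFin; [|exact: measurable_I01| | |exact: powR_ge0].
- rewrite integral_indic//; last exact: measurable_I01.
  rewrite setIidl; last exact: cell_sub.
  rewrite [X in (_ * X)%E](leb_cell R m_ge2 n Gm0) -EFinM; congr (_%:E).
  have V0 := VMr_gt0 R m_ge2 n.
  by rewrite powRB ?(gt_eqF V0) ?implybT// powRr1// ltW.
- by move=> t _; rewrite lee_fin.
- by apply/measurable_EFinP; exact: measurable_indic.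
Qed.

(** The summands do not depend on [k], so the full series bounds the p-th power of the maximal
    function. *)
Lemma powR_block_tail p b N k x : 0 < p -> p <= 1 -> (forall i, 0 <= b i) ->
  cabs (block b k x - block b (minn k N) x) `^ p <=
  \sum_(0 <= i < k - N) b (i + N)%N `^ p * (dk (i + N).+1 x `^ p + dk (i + N) x `^ p).
Proof.
move=> p0 p1 b0; have R0 i : 0 <= b i `^ p * (dk i.+1 x `^ p + dk i x `^ p).
  by rewrite mulr_ge0 ?addr_ge0 ?powR_ge0.
rewrite /block -rmorphB cabs_real; case: (leqP k N) => [kN|/ltnW Nk].
  by rewrite subrr normr0 powR0 ?gt_eqF//; apply: sumr_ge0.
have -> : blockr b k x - blockr b N x =
    \sum_(0 <= i < k - N) b (i + N)%N * (dk (i + N).+1 x - dk (i + N) x).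
  rewrite /blockr -(big_mkord xpredT (fun i => b i * (dk i.+1 x - dk i x))).
  rewrite -(big_mkord xpredT (fun i => b i * (dk i.+1 x - dk i x))).
  by rewrite (big_cat_nat _ (n := N))//= [LHS]addrC addKr -{1}[N]add0n big_addn.
apply: le_trans (_ : (\sum_(0 <= i < k - N) b (i + N)%N *
    (dk (i + N).+1 x + dk (i + N) x)) `^ p <= _).
  rewrite ge0_ler_powR ?nnegrE ?(ltW p0)//.
    by apply: sumr_ge0 => i _; rewrite mulr_ge0// addr_ge0 ?dk_ge0.
  apply: le_trans (ler_norm_sum _ _ _) _; apply: ler_sum => i _.
  rewrite normrM (ger0_norm (b0 _)) ler_wpM2l//.
  by apply: le_trans (ler_normB _ _) _; rewrite !ger0_norm ?dk_ge0.
apply: le_trans (powR_subadd_sum _ p0 p1 _) _.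
  by move=> i; rewrite mulr_ge0// addr_ge0 ?dk_ge0.
apply: ler_sum => i _; rewrite powRM ?addr_ge0 ?dk_ge0//.
by rewrite ler_wpM2l ?powR_ge0// powR_subadd ?dk_ge0.
Qed.

Lemma measurable_maxf (g : mart R) : (forall k, fdep m k (g k)) ->
  measurable_fun I01 (fun t => maxf g (vdig t)).
Proof.
move=> hg; rewrite (_ : (fun t => _) =
    (fun t => esups (fun k => (cabs (g k (vdig t)))%:E) 0)).
  apply: measurable_fun_esups => k; apply/measurable_EFinP.
  apply: (@fdep_measurable R m m_ge2 k (@cabs R \o g k)).
  exact/fdep_comp/hg.
apply/funext => t; rewrite /maxf /esups /sdrop; congr ereal_sup.
by apply/seteqP; split=> _ [k _ <-]; exists k.
Qed.

(** [T] acts as a potential: its decrements dominate b_i^p M_i^(p-1), so the tail from [N] is at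
    most T_N and no series has to be evaluated. The factor 2 accounts for the two kernels
    D_(M_(i+1)) and D_(M_i) in each block. *)
Lemma Hpnorm_block_tail p b T N (g : mart R) : 0 < p -> p <= 1 ->
  (forall i, 0 <= b i) -> (forall i, 0 <= T i) ->
  (forall i, b i `^ p * (VM i)%:R `^ (p - 1) <= T i - T i.+1) ->
  (forall k x, Gm x -> g k x = block b k x - block b (minn k N) x) ->
  (Hpnorm m p g <= ((2 * T N) `^ p^-1)%:E)%E.
Proof.
move=> p0 p1 b0 T0 bT hg; rewrite /Hpnorm /Lpe -poweR_EFin.
have pn : p != 0 by rewrite gt_eqF.
apply: gt0_ler_poweR; rewrite ?invr_ge0 ?(ltW p0)//.
- by rewrite in_itv/= leey andbT; apply: integral_ge0 => t _; exact: poweR_ge0.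
- by rewrite in_itv/= leey lee_fin mulr_ge0.
pose h i t := b (i + N)%N `^ p * (dk (i + N).+1 (vdig t) `^ p + dk (i + N) (vdig t) `^ p).
have h0 i t : 0 <= h i t by rewrite mulr_ge0 ?addr_ge0 ?powR_ge0.
have mdk i : measurable_fun I01 (fun t => dk i (vdig t) `^ p).
  apply: (@fdep_measurable R m m_ge2 i (fun x => dk i x `^ p)).
  exact/(fdep_comp (fun z => z `^ p))/dk_fdep.
have mdkE i : measurable_fun I01 (fun t => (dk i (vdig t) `^ p)%:E).
  exact/measurable_EFinP.
have mh i : measurable_fun I01 (EFin \o h i).
  by apply/measurable_EFinP/measurable_funM => //; exact: measurable_funD.
have mI := @measurable_I01 R.
apply: (@le_trans _ _ (\int[leb]_(t in I01) (\sum_(0 <= i <oo) (h i t)%:E))%E).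
  apply: ge0_le_integral => //.
  - by move=> t _; exact: poweR_ge0.
  - apply: (measurableT_comp (measurable_poweR p)).
    have hd k : fdep m k (g k).
      move=> x y Gx Gy xy; rewrite !hg// /block (blockr_fdep b Gx Gy xy).
      rewrite (@blockr_fdep R m b (minn k N) x y)// => j jn.
      by apply: xy; apply: leq_trans jn _; exact: geq_minl.
    exact: measurable_maxf hd.
  - have hE i t : I01 t -> i \in xpredT -> (0 <= (h i t)%:E)%E by rewrite lee_fin.
    exact: (ge0_emeasurable_sum (P := xpredT) hE (fun i _ => mh i)).
  move=> t It; set S := (\sum_(0 <= i <oo) _)%E.
  have S0 : (0 <= S)%E by apply: nneseries_ge0 => i _ _; rewrite lee_fin.
  (* Taking the p-th root of the bound lets the supremum be estimated term by term, without
     commuting it with the power. *)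
  apply: (@le_trans _ _ ((S `^ p^-1) `^ p)%E); last first.
    by rewrite -poweRrM mulVf// poweRe1.
  apply: gt0_ler_poweR; rewrite ?(ltW p0)//.
  - rewrite in_itv/= leey andbT; apply: le_ereal_sup_tmp; exists (cabs (g 0%N (vdig t)))%:E => //.
    by rewrite lee_fin cabs_ge0.
  - by rewrite in_itv/= leey poweR_ge0.
  apply: ge_ereal_sup => _ [k _ <-]; rewrite hg; last exact: vdig_Gm.
  set c := cabs _; have c0 : 0 <= c by exact: cabs_ge0.
  have -> : c%:E = ((c `^ p)%:E `^ p^-1)%E by rewrite -poweR_EFin -poweRrM mulfV// poweRe1.
  apply: gt0_ler_poweR; rewrite ?invr_ge0 ?(ltW p0)// ?in_itv/= ?leey ?S0 ?andbT ?lee_fin ?powR_ge0//.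
  apply: (@le_trans _ _ (\sum_(0 <= i < k - N) (h i t)%:E)%E).
    by rewrite sumEFin lee_fin; exact: powR_block_tail.
  by apply: nneseries_lim_ge => i _ _; rewrite lee_fin.
rewrite /Defs.leb integral_nneseries//; last by move=> i t _; rewrite lee_fin.
have Ih i : (\int[leb]_(t in I01) (h i t)%:E = (b (i + N)%N `^ p *
    ((VM (i + N).+1)%:R `^ (p - 1) + (VM (i + N))%:R `^ (p - 1)))%:E)%E.
  rewrite /h; under eq_integral do rewrite EFinM EFinD.
  rewrite /Defs.leb ge0_integralZl_EFin; [|exact: mI| | |exact: powR_ge0].
  - rewrite ge0_integralD; [|exact: mI| | | |]; try by [move=> t _; rewrite lee_fin powR_ge0|exact: mdkE].
    rewrite [X in (_ * (X + _))%E](integral_dk_powR _ p0).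
    by rewrite [X in (_ * (_ + X))%E](integral_dk_powR _ p0).
  - by move=> t _; rewrite -EFinD lee_fin addr_ge0 ?powR_ge0.
  - exact: (emeasurable_funD (mdkE _) (mdkE _)).
apply: lime_le.
  by apply: is_cvg_nneseries => i _ _; apply: integral_ge0 => t _; rewrite lee_fin.
near=> n; rewrite (eq_bigr (fun i => (b (i + N)%N `^ p *
    ((VM (i + N).+1)%:R `^ (p - 1) + (VM (i + N))%:R `^ (p - 1)))%:E)) => [|i _]; last exact: Ih.
rewrite sumEFin lee_fin; apply: (@le_trans _ _ (2 * (T N - T (n + N)%N))); last first.
  by rewrite ler_pM2l// gerBl.
elim: (n) => [|k IH]; first by rewrite big_nil add0n subrr mulr0.
rewrite big_nat_recr//= addSn; set i := (k + N)%N in IH *.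
(* As p - 1 <= 0, the larger kernel contributes no more than the smaller one. *)
have hi : (VM i.+1)%:R `^ (p - 1) <= (VM i)%:R `^ (p - 1) :> R.
  by apply: ler_powRN; rewrite ?VMr_gt0 ?ler_nat ?leq_VM ?subr_le0.
have := ler_wpM2l (powR_ge0 (b i) p) hi; have := bT i; move: IH; rewrite mulrDr; lra.
Unshelve. all: by end_near.
Qed.

Lemma eq_condexp n (u v : (nat -> nat) -> VC R) x : (forall y, Gm y -> u y = v y) ->
  condexp m n u x = condexp m n v x.
Proof.
move=> uv; rewrite /condexp; congr (_ * cint _ _); apply/funext => t.
by apply: uv; exact: vdig_Gm.
Qed.

Lemma omegaHp_block p b T N : 0 < p -> p <= 1 ->
  (forall i, 0 <= b i) -> (forall i, 0 <= T i) ->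
  (forall i, b i `^ p * (VM i)%:R `^ (p - 1) <= T i - T i.+1) ->
  (omegaHp m p N (block b) <= ((2 * T N) `^ p^-1)%:E)%E.
Proof.
move=> p0 p1 b0 T0 bT; apply: (Hpnorm_block_tail p0 p1 b0 T0 bT) => k x Gx.
congr (_ - _); rewrite -(condexp_mart m_ge2 k N (block_mart m_ge2 b) Gx).
by apply: eq_condexp => y; exact: Spart_block.
Qed.

Lemma in_Hp_block p b T : 0 < p -> p <= 1 ->
  (forall i, 0 <= b i) -> (forall i, 0 <= T i) ->
  (forall i, b i `^ p * (VM i)%:R `^ (p - 1) <= T i - T i.+1) ->
  in_Hp m p (block b).
Proof.
move=> p0 p1 b0 T0 bT; split; first exact: block_mart.
apply: le_lt_trans (ltry _).
(* The martingale starts at 0, so the tail from N = 0 is the martingale itself. *)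
apply: (@Hpnorm_block_tail p b T 0 _ p0 p1 b0 T0 bT) => k x Gx.
have z : block b 0 x = 0 by rewrite /block /blockr big_ord0.
by rewrite minn0 z subr0.
Qed.

End HardyNorm.

(** * Fejér means off I_s(0), and measurability of their errors *)

Section FejerMeans.
Variables (R : realType) (m : nat -> nat).
Hypothesis m_ge2 : forall k, (2 <= m k)%N.
Local Notation VM := (VM m).
Local Notation vdig := (@Defs.vdig R m).
Local Notation Gm := (Gm m).
Local Notation I01 := (@Defs.I01 R).
Local Notation leb := (@Defs.leb R).
Local Notation psi := (@Defs.psi R m).
Local Notation cell := (@cell R m).
Local Notation block := (@block R m).
Local Notation Dk := (@Dk R m).
Local Notation Fk := (@Fk R m).
Implicit Types (x y : nat -> nat) (t p : R) (b : nat -> R).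

(** The kernels D_(M_i) with i >= s are supported in I_s(0), so later blocks contribute nothing at
    [x]. *)
Lemma block_stable b s n x : ~~ zprefix s x -> (s <= n)%N -> block b n x = block b s x.
Proof.
move=> zs /subnK <-; elim: (n - s)%N => [//|d IH]; rewrite addSn -{}IH /block /blockr.
rewrite big_ord_recr /= /dk !ifN ?subrr ?mulr0 ?addr0//.
  by apply: contra zs; apply: zprefixW; exact: leq_addl.
by apply: contra zs; apply: zprefixW; rewrite -addSn leq_addl.
Qed.

Lemma fval_block b s x : ~~ zprefix s x -> fval (block b) x = block b s x.
Proof. by move=> zs; apply: (clim_near (n := s)) => k sk; exact: block_stable. Qed.

Definition fejer_err b n x : R := cabs (fejer m (block b) n x - fval (block b) x).

Lemma natrC n : ((n%:R%:C)%C : VC R) = n%:R.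
Proof. exact: rmorph_nat. Qed.

Lemma fejerM b n x : (0 < n)%N ->
  n%:R * fejer m (block b) n x = \sum_(k < n.+1) Spart m (block b) k x.
Proof.
move=> n0; rewrite /fejer mulrA -natrC -rmorphM mulfV ?pnatr_eq0 -?lt0n//.
rewrite mul1r big_ord_recl [Spart _ _ _ _]/Spart big_ord0 add0r big_add1 /=.
by rewrite big_mkord.
Qed.

(** Off I_s(0) the kernel D_(M_s) vanishes, hence S_(M_s + l) f = f + b_s psi_(M_s) D_l for l <= q;
    summing over [l] gives the last term. *)
Lemma fejer_shift b s q x : Gm x -> ~~ zprefix s x -> (q <= VM s)%N ->
  (VM s + q)%:R * (fejer m (block b) (VM s + q) x - fval (block b) x) =
  (VM s)%:R * (fejer m (block b) (VM s) x - fval (block b) x) +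
  ((b s)%:C)%C * (psi (VM s) x * Fk q.+1 x).
Proof.
move=> Gx zs qs; have V0 := VM_gt0 m_ge2 s.
have D0 : Dk (VM s) x = 0 by rewrite Dk_VM// /dk ifN.
have sS : (VM s + q <= VM s.+1)%N.
  by apply: leq_trans _ (leq_VM_double m_ge2 s); rewrite mul2n -addnn leq_add2l.
rewrite !mulrBr !fejerM ?addn_gt0 ?V0// (fval_block b zs).
(* The orders 0, ..., M_s form one block and make up M_s sigma_(M_s) f; the [q] remaining orders
   follow. *)
have -> : (VM s + q).+1 = (1 * (VM s).+1 + q)%N by rewrite mul1n addSn.
rewrite (sum_ord_blocks (fun k => Spart m (block b) k x)) big_ord1 mul1n.
have E (l : 'I_q) : Spart m (block b) ((VM s).+1 + l) x =
    block b s x + ((b s)%:C)%C * (psi (VM s) x * Dk l.+1 x).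
  have lq : (l.+1 <= VM s)%N by apply: leq_trans (ltn_ord l) qs.
  rewrite addSn -addnS Spart_block_add//; last by apply: leq_trans sS; rewrite leq_add2l.
  rewrite Spart_block// D0 subr0; have := @DkMD R m m_ge2 1 l.+1 s x lq.
  by rewrite mul1n D0 mulr0 add0r => ->.
under [X in _ + X - _]eq_bigr => l _ do rewrite E.
have D00 : Dk 0 x = 0 by rewrite /Dk big_ord0.
have FE : Fk q.+1 x = \sum_(l < q) Dk l.+1 x by rewrite /Fk big_ord_recl D00 add0r.
rewrite big_split /= -!mulr_sumr sumr_const card_ord FE natrD mulrDl.
by rewrite -(mulr_natl _ q); ring.
Qed.

Lemma cabs_natM n (z : VC R) : cabs (n%:R * z) = n%:R * cabs z.
Proof. by rewrite cabsM -natrC cabs_real ger0_norm. Qed.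

(** Triangle inequality in [fejer_shift], divided by M_s + q; the weight M_s / (M_s + q) of the
    second error is at most 1. *)
Lemma fejer_err_lb b s q x : Gm x -> ~~ zprefix s x -> (q <= VM s)%N -> 0 <= b s ->
  b s * cabs (Fk q.+1 x) / (VM s + q)%:R <=
  fejer_err b (VM s + q) x + fejer_err b (VM s) x.
Proof.
move=> Gx zs qs b0; have n0 : 0 < (VM s + q)%:R :> R by rewrite ltr0n addn_gt0 VM_gt0.
set w := Fk _ x.
have E : b s * cabs w = cabs (((b s)%:C)%C * (psi (VM s) x * w)).
  by rewrite cabsM cabs_real (ger0_norm b0) cabsM cabs_psi mul1r.
have := fejer_shift b Gx zs qs; rewrite -/w => /esym/(canRL (addKr _)) Ew.
rewrite ler_pdivrMr// E Ew; apply: le_trans (ler_cabsD _ _) _.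
rewrite cabsN !cabs_natM -/(fejer_err _ _ _) -/(fejer_err _ _ _).
rewrite [leRHS]mulrDl [leRHS]addrC [X in _ <= X + _]mulrC [X in _ <= _ + X]mulrC lerD2r ler_wpM2r ?cabs_ge0//.
by rewrite ler_nat leq_addr.
Qed.

Lemma enc0 s : enc m s (fun=> 0%N) = 0%N.
Proof. by elim: s => //= s ->. Qed.

Lemma nzprefix_pos t : 0 < t < 1 -> exists s, ~~ zprefix s (vdig t).
Proof.
(* This choice gives 1/t < s + 1 <= M_s, so M_s t >= 1 and [t] lies outside the first interval of
   length 1 / M_s. *)
move=> /andP[t0 t1]; pose s := Num.truncn t^-1; exists s.
apply/negP => /zprefixP h.
have Ct : cell s (fun=> 0%N) t by split=> //; rewrite /Defs.I01/= in_itv/= ltW.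
have [_] := (cellP m_ge2 s t (Gm0 m_ge2)).1 Ct.
rewrite enc0 /tau; apply/eqP; rewrite -lt0n truncn_gt0 -ler_pdivrMr// div1r.
by apply: le_trans (ltW (truncnS_gt _)) _; rewrite ler_nat; exact: ltn_VM.
Qed.

Lemma Spart_fdep b k n : (k <= VM n)%N -> fdep m n (Spart m (block b) k).
Proof.
move=> kn x y Gx Gy xy; apply: eq_bigr => j _.
by rewrite (psi_fdep R m_ge2 (n := n) _ Gx Gy xy)// (leq_trans _ kn).
Qed.

Lemma fejer_fdep b n : fdep m n (fejer m (block b) n).
Proof.
move=> x y Gx Gy xy; apply: (congr1 (fun z => _ * z)); apply: eq_big_nat => k /andP[_ kn].
by apply: (Spart_fdep b _ Gx Gy xy); apply: leq_trans (ltn_VM m_ge2 n); exact: leqW.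
Qed.

Lemma fejer_err_measurable b n :
  measurable_fun I01 (fun t => fejer_err b n (vdig t)).
Proof.
(* The left endpoint is discarded: at t = 0 the values f^(k) need not stabilise, while at every
   other point they do. *)
apply/measurable_fun_itv_obnd_cbndP.
pose h k t := cabs (fejer m (block b) n (vdig t) - block b k (vdig t)).
have mh k : measurable_fun I01 (h k).
  apply: (@fdep_measurable R m m_ge2 (maxn n k)
    (fun x => cabs (fejer m (block b) n x - block b k x))) => x y Gx Gy xy.
  have -> : block b k x = block b k y.
    have [h1 _] := block_mart m_ge2 b; apply: (h1 k x y Gx Gy) => j jk.
    by apply: xy; rewrite (leq_trans jk)// leq_maxr.
  have -> : fejer m (block b) n x = fejer m (block b) n y; last by [].
  apply: (fejer_fdep b Gx Gy) => j jn.
  by apply: xy; rewrite (leq_trans jn)// leq_maxl.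
have sub : [set` Interval (BRight 0) (BLeft 1)] `<=` I01.
  by move=> t; rewrite /Defs.I01/= !in_itv/= => /andP[/ltW ->].
apply: (measurable_fun_cvg (h := h)).
  by move=> k; apply: measurable_funS sub (mh k) => //; exact: measurable_I01.
move=> t; rewrite /= in_itv/= => /nzprefix_pos[s zs].
apply: cvg_near_cst; exists s => // k /= sk.
by rewrite /h /fejer_err (fval_block b zs) (block_stable b zs sk).
Qed.

Lemma not_cvg0 (u : nat -> \bar R) (e : R) : 0 < e ->
  (forall N, exists2 n, (N <= n)%N & (e%:E <= u n)%E) -> ~ (u @ \oo --> 0%E).
Proof.
move=> e0 h u0; have e0' : (0 < e%:E)%E by rewrite lte_fin.
have [N _ hN] := u0 _ (nbhs_open_ereal_lt e0').
have [n Nn] := h N; rewrite leNgt => /negP; apply.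
exact: hN.
Qed.

End FejerMeans.

(** * The case p < 1/2: geometric tails and failure of weak convergence *)

Section Counterexamples.
Variables (R : realType) (m : nat -> nat).
Hypothesis m_ge2 : forall k, (2 <= m k)%N.
Local Notation VM := (VM m).
Local Notation vdig := (@Defs.vdig R m).
Local Notation Gm := (Gm m).
Local Notation I01 := (@Defs.I01 R).
Local Notation leb := (@Defs.leb R).
Local Notation cell := (@cell R m).
Local Notation block := (@block R m).
Local Notation Fk := (@Fk R m).
Local Notation fejer_err := (@fejer_err R m).
Implicit Types (x y : nat -> nat) (t p : R) (b : nat -> R).

(** Sum of the geometric series of ratio 2^(2p-1), which bounds the decay of M_i^(2p-1) because
    M_(i+1) >= 2 M_i. *)
Definition tail_coef p : R := (1 - 2 `^ (2 * p - 1))^-1.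

Lemma tail_coef_gt0 p : p < 2^-1 -> 0 < tail_coef p.
Proof.
move=> p2; rewrite invr_gt0 subr_gt0.
have p1 : 0 < 1 - 2 * p by rewrite subr_gt0 -ltr_pdivlMl ?mulr1.
rewrite -[2 * p - 1]opprB powRN invf_lt1 ?powR_gt0//.
by have := @gt0_ltr_powR _ _ p1 1 2; rewrite !nnegrE ltr1n powR1; exact.
Qed.

Lemma tail_telescope p i : 0 < p -> p < 2^-1 ->
  (VM i)%:R `^ p * (VM i)%:R `^ (p - 1) <=
  tail_coef p * (VM i)%:R `^ (2 * p - 1) - tail_coef p * (VM i.+1)%:R `^ (2 * p - 1).
Proof.
move=> p0 p2; have V0 := VMr_gt0 R m_ge2 i.
rewrite -powRD; last by rewrite (gt_eqF V0) implybT.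
have -> : p + (p - 1) = 2 * p - 1 by ring.
rewrite -mulrBr ler_pdivlMl; last by rewrite -invr_gt0; exact: tail_coef_gt0.
have : (VM i.+1)%:R `^ (2 * p - 1) <= 2 `^ (2 * p - 1) * (VM i)%:R `^ (2 * p - 1).
  rewrite -powRM//; apply: ler_powRN; rewrite ?mulr_gt0//.
    by rewrite subr_le0 -ler_pdivlMl ?mulr1// ltW.
  by rewrite -natrM ler_nat leq_VM_double.
lra.
Qed.

Lemma measurable_fejer_err_gt b n (lam : R) :
  measurable (I01 `&` [set t | lam < fejer_err b n (vdig t)]).
Proof.
have := fejer_err_measurable m_ge2 b n (@measurable_I01 R) (Y := `]lam, +oo[%classic).
move=> /(_ (measurable_itv _)); rewrite (_ : _ @^-1` _ = [set t | lam < fejer_err b n (vdig t)])//.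
by apply/seteqP; split=> t; rewrite /= in_itv/= andbT.
Qed.

Lemma weakLp_not_cvg0 p b : 0 < p -> (forall i, b i = (VM i)%:R) ->
  ~ ((fun n : nat => weakLp m p (fun x => fejer m (block b) n x - fval (block b) x))
      @ \oo --> 0%E).
Proof.
(* Two errors with sum at least 1/2 cannot both be at most 1/8, and [d] is half the measure 1 / m_0
   of the set x_0 = 1 on which this is used. *)
move=> p0 bE; pose lam : R := 8^-1; pose d : R := (2 * m 0)%N%:R^-1.
have d0 : 0 < d by rewrite /d invr_gt0 ltr0n muln_gt0/=; exact: m_gt0.
have lp : 0 < lam `^ p by apply: powR_gt0; rewrite /lam invr_gt0 ltr0n.
apply: (@not_cvg0 _ _ (lam `^ p * d)); first exact: mulr_gt0.
(* With s >= 1 the set x_0 = 1 avoids I_s(0). *)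
move=> N; pose s := N.+1; have sV := ltn_VM m_ge2 s.
pose E n := I01 `&` [set t | lam < fejer_err b n (vdig t)].
pose u n := weakLp m p (fun x => fejer m (block b) n x - fval (block b) x).
have small n : (u n < (lam `^ p * d)%:E)%E -> (leb (E n) < d%:E)%E.
  move=> h; rewrite -(@lte_pmul2l _ (lam `^ p)%:E)// -EFinM; apply: le_lt_trans h.
  by apply: ereal_sup_ubound; exists lam => //=; rewrite /lam invr_gt0 ltr0n.
have [h1|/small s1] := leP (lam `^ p * d)%:E (u (VM s + 1)%N).
  by exists (VM s + 1)%N => //; rewrite addn1 ltnW// ltnW// ltnW.
have [h2|/small s2] := leP (lam `^ p * d)%:E (u (VM s)).
  by exists (VM s) => //; rewrite ltnW// ltnW.
have G1 : Gm (fun=> 1%N) by move=> k; exact: m_ge2.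
have sub : cell 1 (fun=> 1%N) `<=` E (VM s + 1)%N `|` E (VM s).
  move=> t [It ht]; have zs : ~~ zprefix s (vdig t).
    by apply/negP => /zprefixP/(_ 0%N isT); rewrite ht.
  (* The case q = 1: [Fk 2] is D_0 + D_1 = 1. *)
  have F2 : Fk 2 (vdig t) = 1.
    by rewrite /Fk /Dk !big_ord_recl !big_ord0 psi0 addr0 add0r addr0.
  have := fejer_err_lb m_ge2 (vdig_Gm m_ge2 t) zs (VM_gt0 m_ge2 s) (b := b).
  rewrite bE F2 (_ : 1 = (1%:C)%C)// cabs_real normr1 mulr1 => /(_ (ler0n _ _)) lb.
  have half : 2^-1 <= (VM s)%:R / (VM s + 1)%:R :> R.
    rewrite ler_pdivlMr ?ltr0n ?addn1// ler_pdivrMl// -natrM ler_nat.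
    by have := VM_gt0 m_ge2 s; lia.
  have [h|h] := ltP lam (fejer_err b (VM s + 1) (vdig t)); [by left; split|].
  by right; split=> //=; move: (le_trans half lb) h; rewrite /lam; lra.
have : (leb (cell 1 (fun=> 1%N)) <= leb (E (VM s + 1)%N) + leb (E (VM s)))%E.
  have m1 := measurable_fejer_err_gt b (VM s + 1) lam.
  have m2 := measurable_fejer_err_gt b (VM s) lam.
  apply: le_trans (measureU2 (@lebesgue_measure R) m1 m2).
  by apply: le_measure; rewrite ?inE//; [exact: measurable_cell|exact: measurableU].
rewrite leb_cell// => h; have := le_lt_trans h (lteD s1 s2).
rewrite -EFinD lte_fin /d VMS VM0 mul1n natrM invfM.
by rewrite -mulrDl -[X in X + X]mul1r -splitr mul1r ltxx.
Qed.

End Counterexamples.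

(** * The case p = 1/2: lacunary orders and the integral lower bound *)

Section HalfNorm.
Variables (R : realType) (m : nat -> nat).
Hypothesis m_ge2 : forall k, (2 <= m k)%N.
Local Notation VM := (VM m).
Local Notation vdig := (@Defs.vdig R m).
Local Notation Gm := (Gm m).
Local Notation I01 := (@Defs.I01 R).
Local Notation leb := (@Defs.leb R).
Local Notation cell := (@cell R m).
Local Notation block := (@block R m).
Local Notation Fk := (@Fk R m).
Local Notation fejer_err := (@fejer_err R m).
Implicit Types (x y : nat -> nat) (t p : R) (b : nat -> R).

(* For [x] in the cell of [0, ..., 0, 1, 1] the lacunary gaps in [qs J] make
   [Fk (qs J).+1 x] a unimodular multiple of a sum of order [M_(3 j)^2]; each of the
   [J] cells then contributes a constant to the integral of its square root. *)
Definition qs J : nat := \sum_(j < J) VM (3 * j).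

Lemma qsS j : qs j.+1 = (qs j + VM (3 * j))%N.
Proof. by rewrite /qs big_ord_recr. Qed.

(** It makes q_(j+1) + 1 an admissible remainder in [Fk_two_digits] with s = 3j + 1, the first
    nonzero digit of the cell. *)
Lemma qs_lt j : (qs j.+1 < VM (3 * j).+1)%N.
Proof.
elim: j => [|j IH].
  by rewrite qsS /qs big_ord0 muln0 VM0 add0n VMS VM0 mul1n.
have h1 : (VM (3 * j).+1 <= VM (3 * j.+1))%N by apply: leq_VM => //; lia.
have h2 := leq_VM_double m_ge2 (3 * j.+1).
by rewrite qsS; move: IH h1 h2; lia.
Qed.

Lemma qs_leq J s : (3 * J <= s)%N -> (qs J <= VM s)%N.
Proof.
case: J => [|j] js; first by rewrite /qs big_ord0.
by apply: leq_trans (ltnW (qs_lt j)) _; apply: leq_VM => //; lia.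
Qed.

(** The later terms M_(3i) with i > j are all multiples of M_(3(j+1)). *)
Lemma qs_split j J : (j < J)%N -> exists a, qs J = (a * VM (3 * j.+1) + qs j.+1)%N.
Proof.
move=> /subnK <-; elim: (J - _)%N => [|d [a IH]]; first by exists 0%N.
rewrite addSn qsS IH.
have /dvdnP[e ->] : (VM (3 * j.+1) %| VM (3 * (d + j.+1)))%N by apply: dvdn_VM; lia.
by exists (a + e)%N; rewrite mulnDl addnAC.
Qed.

Lemma leq_sqr_sum q : (q ^ 2 <= 2 * \sum_(l < q.+1) l)%N.
Proof.
elim: q => [|q IH]; first by rewrite big_ord1.
by rewrite big_ord_recr /= mulnDr; apply: leq_trans (leq_add IH (leqnn _)); nia.
Qed.

(* Only the first [3 j + 3] digits [0, ..., 0, 1, 1] are ever used. *)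
Definition twoones j : nat -> nat := fun k => (3 * j < k)%N.

Lemma twoones_Gm j : Gm (twoones j).
Proof. by move=> k; rewrite /twoones; case: (3 * j < k)%N; [exact: m_ge2|exact: m_gt0]. Qed.

Lemma Fk_twoones j J t : (j < J)%N -> cell (3 * j.+1) (twoones j) t ->
  (VM (3 * j))%:R ^+ 2 / 2 <= cabs (Fk (qs J).+1 (vdig t)).
Proof.
move=> jJ [It ht]; have [a ->] := qs_split jJ; rewrite -addnS.
have E : (3 * j.+1 = (3 * j).+1.+2)%N by lia.
have x0 k : (k < (3 * j).+1)%N -> vdig t k = 0%N.
  by move=> kj; rewrite ht ?E ?(ltn_trans kj)// /twoones; case: ltnP => //; lia.
have x1 : vdig t (3 * j).+1 = 1%N by rewrite ht ?E// /twoones; case: ltnP => //; lia.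
have x2 : vdig t (3 * j).+2 = 1%N by rewrite ht ?E// /twoones; case: ltnP => //; lia.
rewrite E (@Fk_two_digits R m m_ge2)//; last 3 first.
- exact: qs_lt.
- by rewrite x1 m_ge2.
- by rewrite x2 m_ge2.
rewrite cabsM cabs_psi// mul1r -natr_sum -natrC cabs_real normr_nat.
rewrite ler_pdivrMr// -natrX -natrM ler_nat [X in (_ <= X)%N]mulnC.
apply: leq_trans (leq_sqr_sum _); rewrite leq_sqr.
by rewrite qsS leq_addl.
Qed.

(** Since M_s + q <= 2 M_s, the coefficient b_s / (M_s + q) is at least 1 / (2 s^2); multiplied by
    M_(3j)^2 / 2 it gives the square of the left-hand side. *)
Lemma fejer_err_powR_lb b J s j t : (3 * J <= s)%N -> (j < J)%N ->
  b s = (VM s)%:R / s%:R ^+ 2 -> cell (3 * j.+1) (twoones j) t ->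
  (VM (3 * j))%:R / (2 * s%:R) <= fejer_err b (VM s + qs J) (vdig t) `^ 2^-1 +
    fejer_err b (VM s) (vdig t) `^ 2^-1.
Proof.
move=> Js jJ bs Ct; have s0 : 0 < s%:R :> R by rewrite ltr0n; lia.
have V0 := VMr_gt0 R m_ge2 s.
have e0 n : 0 <= fejer_err b n (vdig t) by exact: cabs_ge0.
have half0 : 0 <= 2^-1 :> R by [].
apply: le_trans (powR_subadd _ _ (e0 _) (e0 _)) => //; last by rewrite invf_le1// ler1n.
have zs : ~~ zprefix s (vdig t).
  have j1 : ((3 * j).+1 < s)%N by lia.
  have j2 : ((3 * j).+1 < 3 * j.+1)%N by lia.
  by apply/negP => /zprefixP/(_ _ j1); rewrite Ct.2// /twoones ltnSn.
have b0 : 0 <= b s by rewrite bs divr_ge0// sqr_ge0.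
have lb := fejer_err_lb m_ge2 (vdig_Gm m_ge2 t) zs (qs_leq Js) b0.
have F := Fk_twoones jJ Ct.
have -> : (VM (3 * j))%:R / (2 * s%:R) = (((VM (3 * j))%:R / (2 * s%:R)) ^+ 2) `^ 2^-1 :> R.
  by rewrite powR12_sqrt ?sqr_ge0// sqrtr_sqr ger0_norm// divr_ge0// mulr_ge0.
apply: ge0_ler_powR; rewrite ?nnegrE ?sqr_ge0 ?addr_ge0//.
apply: le_trans lb; rewrite bs.
have n2 : (VM s + qs J)%:R <= 2 * (VM s)%:R :> R.
  by rewrite -natrM ler_nat mul2n -addnn leq_add2l qs_leq.
have n0 : 0 < (VM s + qs J)%:R :> R by rewrite ltr0n addn_gt0 VM_gt0.
apply: (@le_trans _ _ ((VM s)%:R / s%:R ^+ 2 * ((VM (3 * j))%:R ^+ 2 / 2) / (2 * (VM s)%:R))).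
  rewrite le_eqVlt; apply/orP; left; apply/eqP; field.
  by rewrite !gt_eqF.
apply: ler_pM; rewrite ?invr_ge0 ?mulr_ge0 ?invr_ge0 ?sqr_ge0//.
  by apply: ler_wpM2l => //; rewrite divr_ge0// sqr_ge0.
by rewrite lef_pV2 ?posrE ?mulr_gt0.
Qed.

Lemma cell_twoones_disj i j t : cell (3 * i.+1) (twoones i) t ->
  cell (3 * j.+1) (twoones j) t -> i = j.
Proof.
move=> Ci Cj; wlog ij : i j Ci Cj / (i < j)%N.
  by move=> h; have [/(h _ _ Ci Cj)//|/(h _ _ Cj Ci)->//|//] := ltngtP i j.
have := Ci.2 (3 * i).+1; rewrite Cj.2 /twoones; last by lia.
by case: ltnP; case: ltnP; lia.
Qed.

(** The cell [j] has measure 1 / M_(3j+3) >= 1 / (M_(3j) B^3), so it contributes at least 1 / (2 s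
    B^3) whatever [j] is. There are J >= s/6 disjoint cells, hence the constant 12; boundedness of
    [m] enters here. *)
Lemma integral_twoones_lb B b J s : (forall k, (m k <= B)%N) ->
  (3 * J <= s)%N -> (s <= 6 * J)%N -> (0 < s)%N ->
  b s = (VM s)%:R / s%:R ^+ 2 ->
  (((12 * B%:R ^+ 3)^-1)%:E <=
    \int[leb]_(t in I01) (fejer_err b (VM s + qs J) (vdig t) `^ 2^-1)%:E +
    \int[leb]_(t in I01) (fejer_err b (VM s) (vdig t) `^ 2^-1)%:E)%E.
Proof.
move=> mB Js sJ s0 bs; have mI := @measurable_I01 R.
have sr0 : 0 < s%:R :> R by rewrite ltr0n.
have B0 : 0 < B%:R :> R by rewrite ltr0n (leq_trans (m_gt0 m_ge2 0)).
have me n : measurable_fun I01 (fun t => (fejer_err b n (vdig t) `^ 2^-1)%:E).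
  apply/measurable_EFinP.
  exact: (measurableT_comp (@measurable_powR R 2^-1) (fejer_err_measurable m_ge2 b n)).
have e0 n t : (0 <= (fejer_err b n (vdig t) `^ 2^-1)%:E)%E by rewrite lee_fin powR_ge0.
rewrite /Defs.leb -ge0_integralD; [|exact: mI|by []|exact: me|by []|exact: me].
pose C j := cell (3 * j.+1) (twoones j).
have mC j : measurable (C j) by exact: (measurable_cell m_ge2 _ (@twoones_Gm j)).
pose c j : R := (VM (3 * j))%:R / (2 * s%:R).
have c0 j : 0 <= c j by rewrite divr_ge0// mulr_ge0.
have mcC j : measurable_fun I01 (fun t => ((c j)%:E * (\1_(C j) t)%:E)%E).
  by apply: measurable_funeM; apply/measurable_EFinP; exact: measurable_indic.
apply: (@le_trans _ _ (\int[@lebesgue_measure R]_(t in I01)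
    \sum_(j < J) ((c j)%:E * (\1_(C j) t)%:E))%E).
  rewrite ge0_integral_sum; [|exact: mI|by move=> j; exact: mcC|]; last first.
    by move=> j t _; rewrite -EFinM lee_fin mulr_ge0.
  rewrite (eq_bigr (fun j : 'I_J => (c j / (VM (3 * j.+1))%:R)%:E)); last first.
    move=> j _; rewrite ge0_integralZl_EFin; [|exact: mI| | |exact: c0].
    - rewrite integral_indic; [|exact: mI|exact: mC].
      rewrite setIidl; last exact: cell_sub.
      by rewrite [X in (_ * X)%E](leb_cell R m_ge2 _ (@twoones_Gm j)).
    - by move=> t _; rewrite lee_fin.
    - by apply/measurable_EFinP; apply: measurable_indic; exact: mC.
  rewrite sumEFin lee_fin.
  apply: (@le_trans _ _ (\sum_(j < J) (2 * s%:R * B%:R ^+ 3)^-1)).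
    rewrite sumr_const card_ord -[leRHS]mulr_natl ler_pdivlMr; last by rewrite !mulr_gt0// exprn_gt0.
    rewrite mulrC ler_pdivrMr; last by rewrite mulr_gt0// exprn_gt0.
    have : s%:R <= 6 * J%:R :> R by rewrite -natrM ler_nat.
    move=> h; have B3 : 0 < B%:R ^+ 3 :> R by rewrite exprn_gt0.
    nra.
  apply: ler_sum => j _; rewrite /c.
  have V0 := VMr_gt0 R m_ge2 (3 * j); have V3 := VMr_gt0 R m_ge2 (3 * j.+1).
  have h : (VM (3 * j.+1))%:R <= (VM (3 * j))%:R * B%:R ^+ 3 :> R.
    rewrite -natrX -natrM ler_nat (_ : 3 * j.+1 = (3 * j).+3)%N; last by lia.
    by rewrite !VMS !expnS expn0 muln1 -!mulnA !leq_mul.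
  have -> : (2 * s%:R * B%:R ^+ 3)^-1 =
      (VM (3 * j))%:R / (2 * s%:R) / ((VM (3 * j))%:R * B%:R ^+ 3) :> R.
    by field; rewrite !gt_eqF.
  apply: ler_wpM2l; first exact: c0.
  by rewrite lef_pV2// posrE mulr_gt0// exprn_gt0.
apply: ge0_le_integral => //.
- by move=> t _; apply: sume_ge0 => j _; rewrite -EFinM lee_fin mulr_ge0.
- by apply: emeasurable_sum => j; exact: mcC.
- by apply: emeasurable_funD; exact: me.
(* The cells are disjoint, so at most one term of the sum survives at [t]. *)
move=> t It; have [[j Cj]|nC] := pselect (exists j : 'I_J, C j t).
  rewrite (bigD1 j)//= big1 => [|i ij].
    rewrite adde0 indicE mem_set// mule1 -EFinD lee_fin.
    exact: fejer_err_powR_lb.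
  rewrite indicE memNset ?mule0// => Ci.
  by move: ij => /eqP; apply; apply/val_inj; exact: (cell_twoones_disj Ci Cj).
rewrite big1 => [|j _]; first by rewrite adde_ge0.
by rewrite indicE memNset ?mule0// => Cj; apply: nC; exists j.
Qed.

Lemma Lpnorm_not_cvg0 B b : (forall k, (m k <= B)%N) ->
  (forall i, b (2 ^ i)%N = (VM (2 ^ i))%:R / (2 ^ i)%N%:R ^+ 2) ->
  ~ ((fun n : nat => Lpnorm m (2^-1) (fun x => fejer m (block b) n x - fval (block b) x))
      @ \oo --> 0%E).
Proof.
move=> mB bE; have B0 : 0 < B%:R :> R by rewrite ltr0n (leq_trans (m_gt0 m_ge2 0)).
(* Half the bound for the sum of the two integrals, so one of them reaches [e]. *)
pose e : R := (24 * B%:R ^+ 3)^-1.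
have e0 : 0 < e by rewrite invr_gt0 mulr_gt0 ?exprn_gt0.
pose I n := (\int[leb]_(t in I01) (fejer_err b n (vdig t) `^ 2^-1)%:E)%E.
have big n : (e%:E <= I n)%E -> ((e `^ 2^-1^-1)%:E <=
    Lpnorm m (2^-1) (fun x => (fejer m (block b) n x - fval (block b) x)%R))%E.
  move=> h; rewrite /Lpnorm /Lpe -poweR_EFin; apply: gt0_ler_poweR => //.
  - by rewrite in_itv/= leey lee_fin ltW.
  - by rewrite in_itv/= leey andbT; apply: integral_ge0 => t _; rewrite lee_fin powR_ge0.
apply: (@not_cvg0 _ _ (e `^ 2^-1^-1)); first exact: powR_gt0.
(* A power of 2, where b_s is prescribed; s >= 4 guarantees s <= 6 J after the division by 3. *)
move=> N; pose s := (2 ^ N.+2)%N; pose J := (s %/ 3)%N.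
have sN : (N <= s)%N by rewrite /s; apply: leq_trans (ltnW (ltn_expl N.+2 (isT : 1 < 2)%N)); lia.
have s4 : (4 <= s)%N by rewrite /s !expnS; have := expn_gt0 2 N; lia.
have sV := ltn_VM m_ge2 s.
have := @integral_twoones_lb B b J s mB; rewrite /J.
move=> /(_ ltac:(lia) ltac:(lia) ltac:(lia) (bE _)) lb.
have [/big h|h1] := leP e%:E (I (VM s + qs J)%N); first by exists (VM s + qs J)%N => //; lia.
have [/big h|h2] := leP e%:E (I (VM s)); first by exists (VM s) => //; lia.
have := le_lt_trans lb (lteD h1 h2); rewrite -EFinD lte_fin.
rewrite (_ : e + e = (12 * B%:R ^+ 3)^-1) ?ltxx// /e; field.
by rewrite gt_eqF.
Qed.

End HalfNorm.

(** * Weights along the powers of 2 with telescoping tails *)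

Section LogTelescope.
Variable R : realType.

(* [dyadic_weight i] is [1 / i] when [i] is a power of 2 and [0] otherwise; writing it
   as a difference makes its tails telescope. *)
Definition dyadic_tail (i : nat) : R := 2 / (2 ^ up_log 2 i)%N%:R.

Definition dyadic_weight i : R := dyadic_tail i - dyadic_tail i.+1.

Lemma dyadic_tail_ge0 i : 0 <= dyadic_tail i.
Proof. by rewrite divr_ge0. Qed.

Lemma dyadic_tail_le i : (0 < i)%N -> dyadic_tail i <= 2 / i%:R.
Proof.
move=> i0; rewrite ler_wpM2l// lef_pV2 ?posrE ?ltr0n ?expn_gt0//.
by rewrite ler_nat up_logP.
Qed.

Lemma dyadic_weight_ge0 i : 0 <= dyadic_weight i.
Proof.
rewrite subr_ge0 ler_wpM2l// lef_pV2 ?posrE ?ltr0n ?expn_gt0//.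
by rewrite ler_nat leq_exp2l// leq_up_log.
Qed.

(** The rounded-up logarithm jumps exactly after 2^i, and 2/2^i - 2/2^(i+1) = 1/2^i. *)
Lemma dyadic_weight_exp i : dyadic_weight (2 ^ i) = (2 ^ i)%N%:R^-1.
Proof.
rewrite /dyadic_weight /dyadic_tail up_expnK// (up_log_eq (n := i))//.
  by rewrite expnS natrM; field; rewrite pnatr_eq0 expn_eq0.
by rewrite ltnSn expnS; have := expn_gt0 2 i; lia.
Qed.

End LogTelescope.

Theorem theorem2 (R : realType) (m : nat -> nat) :
  (forall k, (2 <= m k)%N) -> (exists B : nat, forall k, (m k <= B)%N) ->
  (* (a) *)
  (forall p : R, 0 < p -> p < 2^-1 ->
    exists f : mart R, in_Hp m p f /\
      (exists (C : R) (N0 : nat), forall N : nat, (N0 <= N)%N ->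
         (omegaHp m p N f <= (C * ((VM m N)%:R `^ (p^-1 - 2))^-1)%:E)%E) /\
      ~ ((fun n : nat => weakLp m p (fun x => fejer m f n x - fval f x))
           @ \oo --> 0%E))
  /\
  (* (b) *)
  (exists f : mart R, in_Hp m (2^-1) f /\
      (exists (C : R) (N0 : nat), forall N : nat, (N0 <= N)%N ->
         (omegaHp m (2^-1) N f <= (C / (N%:R ^+ 2))%:E)%E) /\
      ~ ((fun n : nat => Lpnorm m (2^-1) (fun x => fejer m f n x - fval f x))
           @ \oo --> 0%E)).
Proof.
move=> m_ge2 [B mB]; split=> [p p0 p2|].
  pose b i : R := (VM m i)%:R.
  pose T i : R := tail_coef p * (VM m i)%:R `^ (2 * p - 1).
  have p1 : p <= 1 by apply: (le_trans (ltW p2)); rewrite invf_le1// ler1n.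
  have b0 i : 0 <= b i by [].
  have C0 := tail_coef_gt0 p2.
  have T0 i : 0 <= T i by rewrite mulr_ge0 ?powR_ge0// ltW.
  have bT i : b i `^ p * (VM m i)%:R `^ (p - 1) <= T i - T i.+1 by exact: tail_telescope.
  exists (block m b); split; first exact: in_Hp_block p0 p1 b0 T0 bT.
  split; last exact: weakLp_not_cvg0.
  exists ((2 * tail_coef p) `^ p^-1), 0%N => N _.
  apply: le_trans (omegaHp_block m_ge2 N p0 p1 b0 T0 bT) _.
  rewrite lee_fin /T mulrA powRM ?powR_ge0 ?mulr_ge0 ?(ltW C0)// -powRrM -powRN.
  rewrite (_ : (2 * p - 1) * p^-1 = - (p^-1 - 2))//.
  by field; rewrite gt_eqF.
(* The square is chosen so that b_i^(1/2) M_i^(-1/2) is the weight itself, the decrement of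
   [dyadic_tail]. *)
pose b i : R := (VM m i)%:R * dyadic_weight R i ^+ 2.
have h0 : 0 < 2^-1 :> R by rewrite invr_gt0.
have h1 : 2^-1 <= 1 :> R by rewrite invf_le1// ler1n.
have b0 i : 0 <= b i by rewrite mulr_ge0 ?sqr_ge0.
have T0 := @dyadic_tail_ge0 R.
have bT i : b i `^ 2^-1 * (VM m i)%:R `^ (2^-1 - 1) <= dyadic_tail R i - dyadic_tail R i.+1.
  rewrite powRM ?sqr_ge0// mulrAC -powRD; last first.
    by rewrite (gt_eqF (VMr_gt0 R m_ge2 i)) implybT.
  rewrite (_ : 2^-1 + (2^-1 - 1) = 0); last by field.
  by rewrite powRr0 mul1r powR12_sqrt ?sqr_ge0// sqrtr_sqr ger0_norm// dyadic_weight_ge0.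
exists (block m b); split; first exact: in_Hp_block h0 h1 b0 T0 bT.
split; last first.
  apply: (Lpnorm_not_cvg0 m_ge2 mB) => i.
  by rewrite /b dyadic_weight_exp exprVn.
(* The tail is at most 2/N for N >= 1, and (2 * 2/N)^2 = 16/N^2. *)
exists 16, 1%N => N N1.
apply: le_trans (omegaHp_block m_ge2 N h0 h1 b0 T0 bT) _.
rewrite lee_fin invrK powR_mulrn ?mulr_ge0//.
have N0 : 0 < N%:R :> R by rewrite ltr0n.
rewrite (_ : 16 / N%:R ^+ 2 = (2 * (2 / N%:R)) ^+ 2); last first.
  by field; rewrite gt_eqF.
rewrite lerXn2r ?nnegrE ?mulr_ge0 ?divr_ge0//.
by rewrite ler_wpM2l// dyadic_tail_le.
Qed.
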